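(* Assume (A) and $c_1<c_1^F$. Let $t^*>t_0$ minimize $t\mapsto\sup_{s\in(0,t)}\Upsilon(s,t)$ over $t>t_0$ and let $s^*\in(0,t^* )$ maximize $s\mapsto\Upsilon(s,t^* )$ over $(0,t^* )$; assume $\bar v>0$ on $(-t^*,0)$ and $\bar m(-s^* )\neq0$. Suppose $$m(-s)\le\rho(-s)\quad\text{for all } s\in(0,t^* ).$$ Then $J=\inf_{t>t_0}\sup_{s\in(0,t)}\Upsilon(s,t)=\Lambda_{s^*,t^*}(b+c_2t^*,\ b+c_2t^*-c_1s^* )$, and the path $$f^*(r):=-\mathbb E\big(A(r,0)\mid A(-t^*,0)=b+c_2t^*,\ A(-s^*,0)=c_1s^*\big)=-\theta_1^*\Gamma(-r,t^* )-\theta_2^*\Gamma(-r,s^* ),$$ with $(\theta_1^*,\theta_2^* )^\top:=\Sigma(s^*,t^* )^{-1}(b+c_2t^*,c_1s^* )^\top$, satisfies $f^*\in\overline{\mathcal S}$ and $I(f^* )=J$.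
   Context: Let $v:[0,\infty)\to[0,\infty)$ be continuous with $v(0)=0$ and $\lim_{t\to\infty}v(t)/t^{\alpha}=0$ for some $\alpha<2$. $A$ is a centered Gaussian process on $\mathbb R$ with continuous paths, $A(0)=0$, stationary increments and $\mathrm{Var}(A(t)-A(s))=v(|t-s|)$; $A(s,t):=A(t)-A(s)$; $\Gamma(s,t):=\tfrac12(v(|s|)+v(|t|)-v(|t-s|))$; $A_1,A_2,\dots$ i.i.d. copies. $\Omega$: continuous $\omega:\mathbb R\to\mathbb R$ with $\omega(0)=0$, $\omega(t)/(1+|t|)\to0$ as $t\to\pm\infty$, norm $\sup_t|\omega(t)|/(1+|t|)$. $R$: reproducing kernel Hilbert space of $\Gamma$; $I(\omega)=\frac12\|\omega\|_R^2$ on $R$, $\infty$ elsewhere. Fix $b>0$, $c_1>c_2>0$, $t_0:=b/(c_1-c_2)$; $Q_{2,n}:=\sup_{t>0}(\sum_{i=1}^nA_i(-t,0)-nc_2t)-\sup_{s>0}(\sum_{i=1}^nA_i(-s,0)-nc_1s)$; $J:=-\lim_n\frac1n\log\mathbb P(Q_{2,n}>nb)$; $\mathcal S:=\{f\in\Omega:\exists t>t_0\ \forall s\in(0,t):f(-s)-f(-t)>b+c_2t-c_1s\}$. For $0<s<t$, $\Sigma(s,t):=\begin{pmatrix}v(t)&\Gamma(s,t)\\ \Gamma(s,t)&v(s)\end{pmatrix}$ (assumed nonsingular), $\Lambda_{s,t}(y,z):=\frac12(y,z)\Sigma(t-s,t)^{-1}(y,z)^\top$, $k(s,t):=\frac{\Gamma(s,t)}{v(t)}(b+c_2t)$,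 $\Upsilon(s,t):=\Lambda_{s,t}(b+c_2t,b+c_2t-c_1s)$ if $k(s,t)>c_1s$, else $(b+c_2t)^2/(2v(t))$. $L_c(t):=(b+ct)^2/(2v(t))$; $t^F_{c_2}$ a minimizer of $L_{c_2}$ on $(0,\infty)$; $c_1^F:=\sup_{s\in(0,t^F_{c_2})}k(s,t^F_{c_2})/s$. Conditional quantities given $A(-t^*,0)=b+c_2t^*$: for $r,r_1,r_2\in(-t^*,0)$, $\bar{\mathbb E}A(r,0):=\frac{\Gamma(-r,t^* )}{v(t^* )}(b+c_2t^* )$, $\bar\Gamma(r_1,r_2):=\Gamma(-r_1,-r_2)-\frac{\Gamma(-r_1,t^* )\Gamma(-r_2,t^* )}{v(t^* )}$, $\bar v(r):=\bar\Gamma(r,r)$; $\bar m(r):=\frac{\bar{\mathbb E}A(r,0)+c_1r}{\sqrt{\bar v(r)}}$, $m(r):=\bar m(r)/\bar m(-s^* )$, $\rho(r):=\frac{\bar\Gamma(r,-s^* )}{\sqrt{\bar v(r)\bar v(-s^* )}}$. Assumption (A): $\sqrt v\in C^2([0,\infty))$, strictly increasing and strictly concave. *)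

(* Defs.v *)
From HB Require Import structures.
From mathcomp Require Import all_boot all_order all_algebra.
From mathcomp Require Import all_classical all_reals all_analysis.
Set Implicit Arguments. Unset Strict Implicit. Unset Printing Implicit Defensive.
Import Order.TTheory GRing.Theory Num.Theory.
Import numFieldNormedType.Exports.
Local Open Scope classical_set_scope.
Local Open Scope ring_scope.

Section Defs.
Variable R : realType.
Implicit Types (v f g : R -> R) (s t r x y z l b c alpha : R).

Definition variance_fun v : Prop :=
  [/\ (forall t, 0 <= t -> 0 <= v t),
      {within `[0, +oo[, continuous v},
      v 0 = 0 &
      exists alpha : R, alpha < 2 /\ (fun t => v t / t `^ alpha) @ +oo --> (0 : R)].

Definition assumptionA v : Prop :=
  let g := fun x => Num.sqrt (v x) in
  [/\ exists g1 g2 : R -> R,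
        [/\ (forall t, 0 < t -> is_derive t 1 g (g1 t) /\ is_derive t 1 g1 (g2 t)),
            {within `[0, +oo[, continuous g1} &
            {within `[0, +oo[, continuous g2}],
      (forall x y, 0 <= x -> x < y -> g x < g y) &
      (forall x y l, 0 <= x -> 0 <= y -> x != y -> 0 < l -> l < 1 ->
          l * g x + (1 - l) * g y < g (l * x + (1 - l) * y))].

Definition Gam v s t : R := (v `|s| + v `|t| - v `|t - s|) / 2.

(* Sigma(s,t) = [[v t, Gam s t],[Gam s t, v s]] ; its determinant *)
Definition detSigma v s t : R := v t * v s - Gam v s t ^+ 2.

(* (1/2) (y,z) M^{-1} (y,z)^T for the symmetric 2x2 matrix M = [[a,c],[c,d]] *)
Definition halfQuadInv (a c d y z : R) : R :=
  (d * y ^+ 2 - 2 * c * y * z + a * z ^+ 2) / (2 * (a * d - c ^+ 2)).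

Definition Lam v s t y z : R :=
  halfQuadInv (v t) (Gam v (t - s) t) (v (t - s)) y z.

Definition kfun v b (c2 : R) s t : R := Gam v s t / v t * (b + c2 * t).

Definition Ups v b (c1 c2 : R) s t : R :=
  if c1 * s < kfun v b c2 s t then Lam v s t (b + c2 * t) (b + c2 * t - c1 * s)
  else (b + c2 * t) ^+ 2 / (2 * v t).

Definition Lc v b c t : R := (b + c * t) ^+ 2 / (2 * v t).

Definition supUps v b (c1 c2 : R) t : \bar R :=
  ereal_sup [set (Ups v b c1 c2 s t)%:E | s in `]0, t[].

(* c_1^F computed from a minimizer tF of L_{c2} *)
Definition c1F v b (c2 tF : R) : \bar R :=
  ereal_sup [set (kfun v b c2 s tF / s)%:E | s in `]0, tF[].

(* conditional quantities given A(-ts,0) = b + c2 ts *)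
Definition Ebar v b (c2 ts : R) r : R := Gam v (- r) ts / v ts * (b + c2 * ts).
Definition Gbar v (ts r1 r2 : R) : R :=
  Gam v (- r1) (- r2) - Gam v (- r1) ts * Gam v (- r2) ts / v ts.
Definition vbar v (ts : R) r : R := Gbar v ts r r.
Definition mbar v b (c1 c2 ts : R) r : R :=
  (Ebar v b c2 ts r + c1 * r) / Num.sqrt (vbar v ts r).
Definition m_ratio v b (c1 c2 ts ss : R) r : R :=
  mbar v b c1 c2 ts r / mbar v b c1 c2 ts (- ss).
Definition rhofun v (ts ss : R) r : R :=
  Gbar v ts r (- ss) / (Num.sqrt (vbar v ts r) * Num.sqrt (vbar v ts (- ss))).

(* (theta1, theta2)^T = Sigma(ss,ts)^{-1} (b + c2 ts, c1 ss)^T *)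
Definition theta1 v b (c1 c2 ss ts : R) : R :=
  (v ss * (b + c2 * ts) - Gam v ss ts * (c1 * ss)) / detSigma v ss ts.
Definition theta2 v b (c1 c2 ss ts : R) : R :=
  (- Gam v ss ts * (b + c2 * ts) + v ts * (c1 * ss)) / detSigma v ss ts.

Definition fstar v b (c1 c2 ss ts : R) (r : R) : R :=
  - theta1 v b c1 c2 ss ts * Gam v (- r) ts - theta2 v b c1 c2 ss ts * Gam v (- r) ss.

Definition in_Omega f : Prop :=
  [/\ continuous f, f 0 = 0,
      (fun t => f t / (1 + `|t|)) @ +oo --> (0 : R) &
      (fun t => f t / (1 + `|t|)) @ -oo --> (0 : R)].

(* closure in Omega for the norm sup_t |w t|/(1+|t|) *)
Definition Omega_closure (S : set (R -> R)) : set (R -> R) :=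
  [set f | in_Omega f /\ forall e : R, 0 < e ->
     exists g, S g /\ forall r, `|f r - g r| <= e * (1 + `|r|)].

Definition Sset b (c1 c2 : R) : set (R -> R) :=
  [set f | in_Omega f /\ exists t, b / (c1 - c2) < t /\
     forall s, 0 < s -> s < t -> b + c2 * t - c1 * s < f (- s) - f (- t)].

(* ||f||_R^2 = sup { (sum_k a_k f(t_k))^2 : sum_{k,l} a_k a_l Gamma(t_k,t_l) <= 1 },
   = +oo iff f is not in the RKHS (Aronszajn). *)
Definition rkhs_norm2 v f : \bar R :=
  ereal_sup [set x | exists (n : nat) (tm a : 'I_n -> R),
     \sum_(k < n) \sum_(l < n) a k * a l * Gam v (tm k) (tm l) <= 1 /\
     x = ((\sum_(k < n) a k * f (tm k)) ^+ 2)%:E].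

Definition Irate v f : \bar R := (rkhs_norm2 v f * (2^-1 : R)%:E)%E.

End Defs.

Section Prob.
Variables (R : realType) (d : measure_display) (T : measurableType d)
  (P : probability T R).

Definition centered_normal (X : T -> R) (sigma2 : R) : Prop :=
  0 <= sigma2 /\ forall B : set R, measurable B ->
    P (X @^-1` B) = if sigma2 == 0 then \d_(0 : R) B
                    else normal_prob 0 (Num.sqrt sigma2) B.

(* (A i)_i are i.i.d. copies of a centered Gaussian process with covariance
   Gamma, continuous paths and A(0) = 0: the family (A i t)_{i,t} is jointly
   Gaussian, centered, with Cov(A i s, A j t) = [i == j] Gamma(s,t). *)
Definition iid_gaussian_copies (v : R -> R) (A : nat -> R -> T -> R) : Prop :=
  [/\ (forall i t, measurable_fun setT (A i t)),
      (forall i w, continuous (fun t => A i t w)),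
      (forall i w, A i 0 w = 0) &
      (forall (n : nat) (idx : 'I_n -> nat) (tm a : 'I_n -> R),
        centered_normal (fun w => \sum_(k < n) a k * A (idx k) (tm k) w)
          (\sum_(k < n) \sum_(l < n)
             a k * a l * (idx k == idx l)%:R * Gam v (tm k) (tm l)))].

Definition supPart (A : nat -> R -> T -> R) (n : nat) (c : R) (w : T) : \bar R :=
  ereal_sup [set (\sum_(i < n) (A i 0 w - A i (- t) w) - n%:R * c * t)%:E
            | t in `]0, +oo[].

Definition Q2 (A : nat -> R -> T -> R) (c1 c2 : R) (n : nat) (w : T) : \bar R :=
  (supPart A n c2 w - supPart A n c1 w)%E.

Definition logprob_seq (A : nat -> R -> T -> R) (b c1 c2 : R) (n : nat) : R :=
  n%:R^-1 * ln (fine (P [set w | ((n%:R * b)%:E < Q2 A c1 c2 n w)%E])).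

End Prob.

(* Main.v *)
(** Put [B_n(t) := A_1(-t,0) + ... + A_n(-t,0)].  Only one-dimensional Gaussian tails of
linear combinations of the [B_n(t)] are ever used.

Upper bound.  If [Q_{2,n} > n b], then for some [t > t0] the path overflows at [t], i.e.
[B_n(t) >= n (b + c2 t)] and [B_n(t) - B_n(s) >= n (b + c2 t - c1 s)] for all [s].  For every
[s] this lies in a half-space of exponential cost [n Ups(s,t)]; the weights of that
half-space are nonnegative because [sqrt v] is concave and [t >= t0].  As [v(u) = O(u^2)],
dyadic chaining makes oscillations over short intervals superexponentially unlikely, so the
union over a compact range of [t] costs finitely many half-spaces, and [v(t) = O(t^alpha)]
with [alpha < 2] controls large [t].  The compact range contains [t0], where the bound on
[sup_s Ups(s,t)] is obtained by letting [t] decrease to [t0].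

Lower bound.  Let [U] be the combination of [B_n(ts)] and [B_n(ss)] which represents the
optimal path, with a slightly increased first weight.  On [U >= n Var U] the path follows its
regression on [U], because a deviation at a given time forces a tilted half-space of strictly
larger cost; and this regression overflows at [ts] because [m <= rho] says exactly that the
optimal path satisfies all the constraints on [(0, ts)].

The case [k(ss,ts) < c1 ss], in which [Ups(ss,ts)] would not be [Lam], is excluded by letting
[s] tend to [ts] in [m(-s) <= rho(-s)]. *)

Require Import Defs.
From HB Require Import structures.
From mathcomp Require Import all_boot all_order all_algebra.
From mathcomp Require Import all_classical all_reals all_analysis.
From mathcomp Require Import measurable_realfun.
From mathcomp Require Import ring lra.
Import Order.TTheory GRing.Theory Num.Theory.
Import numFieldNormedType.Exports.
Local Open Scope classical_set_scope.
Local Open Scope ring_scope.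
Set Implicit Arguments.
Unset Strict Implicit.
Unset Printing Implicit Defensive.

(** * One-dimensional Gaussian tails *)

Section GaussianTails.
Variable R : realType.
Implicit Types s x q : R.

(** Overflow at [t] is a continuum of constraints indexed by [s]. The upper bound keeps a single [s]
    for each [t], a relaxation that could lose something; it loses nothing here because the cheapest
    path for the two retained times meets all the other constraints. Half-spaces are used in both
    directions because each costs one scalar Gaussian tail: there is no conditioning on a null event
    and no large deviation principle on path space. The price above is that a half-space must
    contain the whole quadrant of constraints, hence the interest in the signs of its weights. The
    price below is that events of probability close to one need a strict margin, whereas the optimal
    path touches its constraints at [s = 0] and [s = ss]; the raised first weight buys a margin at
    every [s < ts], at a cost that can be made arbitrarily small. Minimality of [ts] speaks only of
    [t > t0], but a finite cover needs a closed range of times; this is why [t0] needs an argument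
    of its own. *)

Lemma normal_prob_tail_le s x : 0 < s -> 0 <= x ->
  (normal_prob 0 s `[x, +oo[ <= (expR (- (x ^+ 2 / (2 * s ^+ 2))))%:E)%E.
Proof.
move=> s0 x0; have sn0 : s != 0 by rewrite gt_eqF.
have mI : measurable `[x, +oo[%classic by exact: measurable_itv.
have mpdf (m : R) : measurable_fun `[x, +oo[%classic (EFin \o normal_pdf m s).
  by apply/measurable_EFinP; apply: measurable_funTS; exact: measurable_normal_pdf.
set e := expR _.
(* Comparison with the law recentred at [x]: [y^2 - x^2 - (y - x)^2 = 2 x (y - x) >= 0] on the
   half-line, and the recentred law has mass at most 1. *)
apply: (@le_trans _ _ (e%:E * normal_prob x s `[x, +oo[)%E); last first.
  rewrite -[leRHS]mule1; apply: lee_pmul => //.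
  - by rewrite lee_fin expR_ge0.
  - exact: probability_le1.
rewrite /normal_prob -ge0_integralZl//; last 3 first.
- exact: mpdf.
- by move=> y _; rewrite lee_fin normal_pdf_ge0.
- by rewrite lee_fin expR_ge0.
apply: ge0_le_integral => //.
- by move=> y _; rewrite lee_fin normal_pdf_ge0.
- exact: mpdf.
- by apply: emeasurable_funM; [exact: measurable_cst|exact: mpdf].
move=> y /=; rewrite in_itv/= andbT => xy.
rewrite -EFinM lee_fin !normal_pdfE// mulrCA ler_wpM2l ?normal_peak_ge0//.
rewrite /normal_fun -expRD ler_expR subr0.
rewrite -subr_ge0 -(mulr_natl (s ^+ 2)).
have -> : - (x ^+ 2 / (2 * s ^+ 2)) + - (y - x) ^+ 2 / (2 * s ^+ 2) -
   - y ^+ 2 / (2 * s ^+ 2) = x * (y - x) / s ^+ 2 by field.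
by rewrite mulr_ge0 ?invr_ge0 ?sqr_ge0// mulr_ge0// subr_ge0.
Qed.

(** Only [[x, x + s]] is kept, where the density is least at [x + s]; the length [s] cancels the
    [1 / s] of the peak. *)
Lemma normal_prob_tail_ge s x : 0 < s -> 0 <= x ->
  (((Num.sqrt (pi *+ 2))^-1 * expR (- ((x + s) ^+ 2 / (2 * s ^+ 2))))%:E
     <= normal_prob 0 s `[x, +oo[)%E.
Proof.
move=> s0 x0; have sn0 : s != 0 by rewrite gt_eqF.
have mI : measurable `[x, x + s]%classic by exact: measurable_itv.
apply: (@le_trans _ _ (normal_prob 0 s `[x, x + s]%classic)); last first.
  apply: le_measure; rewrite ?inE//.
  by move=> y /=; rewrite !in_itv/= andbT => /andP[].
rewrite /normal_prob.
have -> : (Num.sqrt (pi *+ 2))^-1 = normal_peak s * s.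
  rewrite /normal_peak -mulrnAr sqrtrM ?sqr_ge0// sqrtr_sqr gtr0_norm//.
  by rewrite invfM mulrAC mulVf// mul1r.
set e := expR _.
apply: (@le_trans _ _ (\int[lebesgue_measure]_(y in `[x, (x + s)%R]) (normal_peak s * e)%:E)%E).
  rewrite integral_cst//= lebesgue_measure_itv/= lte_fin ltrDl s0.
  by rewrite -EFinD addrAC subrr add0r -EFinM lee_fin mulrAC.
apply: ge0_le_integral => //.
- by move=> y _; rewrite lee_fin mulr_ge0 ?normal_peak_ge0 ?expR_ge0.
- by apply/measurable_EFinP; apply: measurable_funTS; exact: measurable_normal_pdf.
move=> y /=; rewrite in_itv/= => /andP[xy yx].
rewrite lee_fin normal_pdfE// ler_wpM2l ?normal_peak_ge0//.
rewrite /normal_fun ler_expR subr0 mulNr lerN2 -(mulr_natl (s ^+ 2)).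
rewrite ler_pM2r ?invr_gt0 ?mulr_gt0 ?exprn_gt0//.
by rewrite ler_sqr ?nnegrE ?addr_ge0 ?(ltW s0)// (le_trans x0).
Qed.

Section centered.
Context {d} {T : measurableType d} (P : probability T R) (X : T -> R) (q : R).
Hypothesis XN : centered_normal P X q.

(** A positive bound [sg] in place of the variance admits the degenerate law [q = 0], which charges
    the half-line only when [x = 0]. *)
Lemma centered_normal_tail_le sg x : q <= sg -> 0 < sg -> 0 <= x ->
  (P [set w | (x <= X w)%R] <= (expR (- (x ^+ 2 / (2 * sg))))%:E)%E.
Proof.
move=> qsg sg0 x0; case: XN => q0 XB.
have -> : [set w | x <= X w] = X @^-1` `[x, +oo[.
  by apply/seteqP; split => w /=; rewrite in_itv/= andbT.
rewrite XB//; have [q0'|qn0] := eqVneq q 0.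
  rewrite diracE mem_setE in_itv/= andbT; case: (leP x 0) => x0'; last first.
    by rewrite lee_fin expR_ge0.
  have -> : x = 0 by apply/eqP; rewrite eq_le x0 x0'.
  by rewrite expr0n/= mul0r oppr0 expR0.
have qp : 0 < q by rewrite lt_neqAle eq_sym qn0.
apply: (le_trans (normal_prob_tail_le _ x0)); first by rewrite sqrtr_gt0.
rewrite lee_fin ler_expR sqr_sqrtr// lerN2.
apply: ler_wpM2l; first exact: sqr_ge0.
by rewrite lef_pV2 ?posrE ?mulr_gt0// ler_pM2l.
Qed.

Lemma centered_normal_tail_ge x : 0 < q -> 0 <= x ->
  (((Num.sqrt (pi *+ 2))^-1 * expR (- ((x + Num.sqrt q) ^+ 2 / (2 * q))))%:E
    <= P [set w | (x <= X w)%R])%E.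
Proof.
move=> qp x0; case: XN => q0 XB.
have -> : [set w | x <= X w] = X @^-1` `[x, +oo[.
  by apply/seteqP; split => w /=; rewrite in_itv/= andbT.
rewrite XB// gt_eqF//.
have := @normal_prob_tail_ge (Num.sqrt q) x; rewrite sqrtr_gt0 sqr_sqrtr//.
exact.
Qed.

End centered.
End GaussianTails.

(** * Covariances and the Gaussian combinations of [B_n] *)

Section Covariance.
Variables (R : realType) (v : R -> R).
Implicit Types s t : R.

Lemma GamC s t : Gam v s t = Gam v t s.
Proof. by rewrite /Gam distrC (addrC (v `|s|)). Qed.

Lemma GamN s t : Gam v (- s) (- t) = Gam v s t.
Proof. by rewrite /Gam !normrN -opprD normrN. Qed.

Lemma Gam_diag t : v 0 = 0 -> Gam v t t = v `|t|.
Proof. by move=> v0; rewrite /Gam subrr normr0 v0; field. Qed.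

Lemma Gam0 t : v 0 = 0 -> Gam v 0 t = 0.
Proof. by move=> v0; rewrite /Gam subr0 normr0 v0; field. Qed.

(* The variance of [a A(-x,0) + b A(-y,0) + c A(-z,0)]. *)
Definition quad3 (a b c x y z : R) : R :=
  a ^+ 2 * v x + b ^+ 2 * v y + c ^+ 2 * v z +
  2 * (a * b * Gam v x y + a * c * Gam v x z + b * c * Gam v y z).

End Covariance.

Section Aggregate.
Context {R : realType} {d : measure_display} {T : measurableType d}.
Variables (P : probability T R) (v : R -> R) (A : nat -> R -> T -> R).
Hypotheses (v0 : v 0 = 0) (iidA : iid_gaussian_copies P v A).
Implicit Types (n : nat) (t x y z u : R) (w : T).

(** This is [B_n(t)]; the lookback time [t] is counted positively. *)
Definition agg n t w : R := \sum_(i < n) (A i 0 w - A i (- t) w).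

(** The double sum is the variance of a combination of values of copy 0, and [centered_normal]
    includes nonnegativity of the variance. *)
Lemma Gam_psd m (tm a : 'I_m -> R) :
  0 <= \sum_(k < m) \sum_(l < m) a k * a l * Gam v (tm k) (tm l).
Proof.
case: iidA => _ _ _ /(_ m (fun=> 0%N) tm a)[].
by under eq_bigr do under eq_bigr do rewrite eqxx mulr1.
Qed.

Lemma aggE n t w : agg n t w = - \sum_(i < n) A i (- t) w.
Proof.
case: iidA => _ _ A0 _; rewrite /agg -sumrN; apply: eq_bigr => i _.
by rewrite A0 sub0r.
Qed.

Lemma agg0 n w : agg n 0 w = 0.
Proof. by rewrite /agg big1// => i _; rewrite oppr0 subrr. Qed.

Lemma continuous_agg n w : continuous (fun t => agg n t w).
Proof.
case: iidA => _ cA _ _; rewrite /agg => t.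
apply: cvg_big => [|i _]; first exact: add_continuous.
apply: cvgB; first exact: cvg_cst.
by apply: (cvg_comp (fun t : R => - t) (fun t => A i t w));
  [exact: opp_continuous|exact: cA].
Qed.

Lemma measurable_agg n t : measurable_fun setT (agg n t).
Proof.
case: iidA => mA _ _ _; apply: measurable_sum => i.
by apply: measurable_funB; exact: mA.
Qed.

Lemma agg_centered_normal n m (tm a : 'I_m -> R) :
  centered_normal P (fun w => \sum_(k < m) a k * agg n (tm k) w)
    (n%:R * \sum_(k < m) \sum_(l < m) a k * a l * Gam v (tm k) (tm l)).
Proof.
case: (iidA) => _ _ _ H.
(* The hypothesis takes a single index, so the pairs (copy, time) are enumerated; independence then
   leaves [n] equal diagonal blocks. *)
pose p (j : 'I_#|{: 'I_n * 'I_m}|) := enum_val j.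
have := H _ (fun j => val (p j).1) (fun j => - tm (p j).2) (fun j => - a (p j).2).
have sumE (F : 'I_n * 'I_m -> R) : \sum_j F (p j) = \sum_(i < n) \sum_(k < m) F (i, k).
  rewrite pair_big/= (eq_bigr (fun q => F q)); last by case.
  rewrite [RHS](reindex (fun j => p j))//=.
  exists enum_rank => j _; [exact: enum_valK | exact: enum_rankK].
congr centered_normal.
  apply/funext => w; rewrite (sumE (fun q => - a q.2 * A (val q.1) (- tm q.2) w))/=.
  rewrite exchange_big; apply: eq_bigr => k _ /=.
  by rewrite aggE mulrN mulr_sumr -sumrN; apply: eq_bigr => i _; rewrite mulNr.
rewrite (sumE (fun q => \sum_l - a q.2 * - a (p l).2 * (val q.1 == val (p l).1)%:R *
   Gam v (- tm q.2) (- tm (p l).2))).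
transitivity (\sum_(i < n) \sum_(k < m) \sum_(l < m) a k * a l * Gam v (tm k) (tm l)).
  apply: eq_bigr => i _; apply: eq_bigr => k _.
  rewrite (sumE (fun q => - a k * - a q.2 * (val i == val q.1)%:R *
   Gam v (- tm k) (- tm q.2)))/= (bigD1 i)//= [X in _ + X]big1 ?addr0; last first.
    move=> j ji; apply: big1 => l _.
    have /negbTE -> : val i != val j by rewrite eq_sym.
    by rewrite mulr0 mul0r.
  by apply: eq_bigr => l _; rewrite eqxx mulr1 mulrNN GamN.
by rewrite sumr_const card_ord mulr_natl.
Qed.

Lemma agg3_centered_normal n (a b c x y z : R) : 0 <= x -> 0 <= y -> 0 <= z ->
  centered_normal P (fun w => a * agg n x w + b * agg n y w + c * agg n z w)
    (n%:R * quad3 v a b c x y z).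
Proof.
move=> x0 y0 z0.
pose tm (k : 'I_3) := if val k == 0%N then x else if val k == 1%N then y else z.
pose co (k : 'I_3) := if val k == 0%N then a else if val k == 1%N then b else c.
have := agg_centered_normal n tm co.
congr centered_normal.
  by apply/funext => w; rewrite !big_ord_recl big_ord0/= addr0 /tm /co/= addrA.
congr (_ * _); rewrite !big_ord_recl !big_ord0/= !addr0 /tm /co/=.
rewrite !Gam_diag// !ger0_norm// (GamC v y x) (GamC v z x) (GamC v z y) /quad3.
by ring.
Qed.

Lemma quad3_ge0 (a b c x y z : R) : 0 <= x -> 0 <= y -> 0 <= z ->
  0 <= quad3 v a b c x y z.
Proof.
move=> x0 y0 z0; have [] := agg3_centered_normal 1 a b c x0 y0 z0.
by rewrite mul1r.
Qed.

Lemma agg3_tail_le n (a b c x y z sg u : R) : 0 <= x -> 0 <= y -> 0 <= z ->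
  (0 < n)%N -> quad3 v a b c x y z <= sg -> 0 < sg -> 0 <= u ->
  (P [set w | (n%:R * u <= a * agg n x w + b * agg n y w + c * agg n z w)%R] <=
    (expR (- (n%:R * (u ^+ 2 / (2 * sg)))))%:E)%E.
Proof.
move=> x0 y0 z0 n0 qsg sg0 u0; have n0' : 0 < n%:R :> R by rewrite ltr0n.
have := centered_normal_tail_le (agg3_centered_normal n a b c x0 y0 z0)
  (sg := n%:R * sg) (x := n%:R * u).
rewrite ler_pM2l// mulr_gt0// mulr_ge0 ?(ltW n0')// => /(_ qsg isT isT).
congr (_ <= (expR (- _))%:E)%E; field.
by rewrite !gt_eqF.
Qed.

(** The threshold equals the variance [N = n q], and [(N + sqrt N)^2 / (2 N) = N / 2 + sqrt N + 1 /
    2]: the rate is [q / 2]. *)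
Lemma agg3_tail_ge n (a b c x y z : R) : 0 <= x -> 0 <= y -> 0 <= z ->
  (0 < n)%N -> let q := quad3 v a b c x y z in 0 < q ->
  (((Num.sqrt (pi *+ 2))^-1 * expR (- (n%:R * (q / 2) + Num.sqrt (n%:R * q) + 2^-1)))%:E <=
   P [set w | (n%:R * q <= a * agg n x w + b * agg n y w + c * agg n z w)%R])%E.
Proof.
move=> x0 y0 z0 n0 q q0; have n0' : 0 < n%:R :> R by rewrite ltr0n.
have := centered_normal_tail_ge (agg3_centered_normal n a b c x0 y0 z0)
  (x := n%:R * q).
rewrite mulr_gt0// mulr_ge0 ?(ltW n0') ?(ltW q0)// => /(_ isT isT).
congr ((_ * expR (- _))%:E <= _)%E; rewrite -/q.
have nq : n%:R * q != 0 by rewrite gt_eqF// mulr_gt0.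
have := sqr_sqrtr (ltW (mulr_gt0 n0' q0)).
move: nq; set s := Num.sqrt _; set N := _ * q => nq sE.
rewrite (_ : _ / _ = N / 2 + s + s ^+ 2 / (2 * N)); last by field.
by rewrite sE mulrA -/N; congr (_ + _); field.
Qed.

Lemma measurable_agg3_ge n (a b c x y z u : R) :
  measurable [set w | (u <= a * agg n x w + b * agg n y w + c * agg n z w)%R].
Proof.
set f := fun w => a * agg n x w + b * agg n y w + c * agg n z w.
have mf : measurable_fun setT f.
  by do ?apply: measurable_funD => //; apply: measurable_funM => //;
    exact: measurable_agg.
have := mf measurableT `[u, +oo[%classic (measurable_itv _).
rewrite setTI; congr measurable.
by apply/seteqP; split => w /=; rewrite in_itv/= andbT.
Qed.

End Aggregate.

(** * Union bounds *)

Section CountableUnion.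
Context {R : realType} {d : measure_display} {T : measurableType d}.
Variable P : probability T R.

Lemma probability_bigcup_le (F : nat -> set T) (u : nat -> R) (c : R) :
  (forall k, measurable (F k)) -> (forall k, (P (F k) <= (u k)%:E)%E) ->
  (forall N, \sum_(k < N) u k <= c) -> (P (\bigcup_k F k) <= c%:E)%E.
Proof.
move=> mF Fu uc.
have /le_trans := measure_sigma_subadditive P mF (bigcupT_measurable _ mF)
  (@subset_refl _ _).
apply.
apply: lime_le; first by apply: is_cvg_nneseries => *.
apply: nearW => N; rewrite big_mkord.
apply: (@le_trans _ _ (\sum_(k < N) (u k)%:E)%E).
  by apply: lee_sum => k _; exact: Fu.
by rewrite sumEFin lee_fin.
Qed.

Lemma probability_bigcup_fin_le (N : nat) (F : nat -> set T) (u : R) :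
  (forall k, measurable (F k)) -> (forall k, (P (F k) <= u%:E)%E) ->
  (P (\bigcup_(k < N) F k) <= (N%:R * u)%:E)%E.
Proof.
move=> mF Fu.
have -> : \bigcup_(k < N) F k = \big[setU/set0]_(k < N) F k.
  by rewrite -bigcup_mkord.
elim: N => [|N IH]; first by rewrite big_ord0 measure0 mul0r.
rewrite big_ord_recr/= -natr1 mulrDl mul1r EFinD.
have mb : measurable (\big[setU/set0]_(k < N) F k).
  exact: bigsetU_measurable.
apply: (le_trans (measureU2 P mb (mF N))).
apply: leeD; [exact: IH|exact: Fu].
Qed.

Lemma probability_le_setU (A B : set T) (a b : R) : measurable A -> measurable B ->
  (P A <= a%:E)%E -> (P B <= b%:E)%E -> (P (A `|` B) <= (a + b)%:E)%E.
Proof.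
move=> mA mB Aa Bb; apply: (le_trans (measureU2 P mA mB)).
rewrite EFinD; apply: leeD => //.
Qed.

End CountableUnion.

(** * Dyadic chaining for continuous functions *)

Section Dyadic.
Variable R : realType.
Implicit Types (f : R -> R) (a t dl C : R) (c : nat -> R).

Definition dyadic a dl (k j : nat) : R := a + dl * (j%:R / 2 ^+ k).

(** An even point of level [k + 1] already belongs to level [k], and an odd one is a single step to
    the right of such a point; so each level is paid for at most once. *)
Lemma dyadic_chain f a dl c :
  (forall k j, (j < 2 ^ k)%N ->
     `|f (dyadic a dl k j.+1) - f (dyadic a dl k j)| <= c k) ->
  forall k j, (j <= 2 ^ k)%N ->
     `|f (dyadic a dl k j) - f a| <= \sum_(i < k.+1) c i.
Proof.
move=> H; have c0 k : 0 <= c k.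
  by apply: le_trans (H k 0%N _); rewrite ?expn_gt0.
have d0 k : dyadic a dl k 0 = a by rewrite /dyadic mul0r mulr0 addr0.
elim=> [|k IH] j; rewrite ?expn0.
  rewrite leq_eqVlt ltnS leqn0 big_ord_recl big_ord0 addr0 => /orP[/eqP->|/eqP->].
    by have := H 0%N 0%N isT; rewrite d0.
  by rewrite d0 subrr normr0.
have half i : dyadic a dl k.+1 i.*2 = dyadic a dl k i.
  rewrite /dyadic exprS -muln2 natrM; congr (_ + _ * _); field.
  by rewrite expf_neq0.
rewrite expnS mul2n => jk; rewrite big_ord_recr/=.
have [odj|evj] := boolP (odd j); last first.
  have jE : j = j./2.*2 by rewrite -[LHS]odd_double_half (negbTE evj).
  rewrite jE half; apply: (le_trans (IH _ _)); last by rewrite lerDl.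
  by rewrite -leq_double -jE.
have jE : j = (j./2.*2).+1 by rewrite -[LHS]odd_double_half odj.
have jk' : (j./2 < 2 ^ k)%N by rewrite -ltn_double -jE.
apply: le_trans (ler_distD (f (dyadic a dl k j./2)) _ _) _.
rewrite [leRHS]addrC; apply: lerD; last by apply: IH; exact: ltnW.
rewrite -half {1}jE; apply: H.
by rewrite expnS mul2n ltn_double.
Qed.

Lemma dyadic_chain_continuous f a dl c C : continuous f -> 0 < dl ->
  (forall k j, (j < 2 ^ k)%N ->
     `|f (dyadic a dl k j.+1) - f (dyadic a dl k j)| <= c k) ->
  (forall k, \sum_(i < k) c i <= C) ->
  forall t, a <= t -> t <= a + dl -> `|f t - f a| <= C.
Proof.
move=> cf dl0 H cC t at_ tdl; apply/ler_addgt0Pr => e e0.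
have /cvgrPdist_lt /(_ e e0) /nbhs_ballP[/= r r0 Hr] := cf t.
have [k kr] : exists k : nat, dl / r < 2 ^+ k.
  exists (Num.truncn (dl / r)).+1.
  have dr : 0 <= dl / r by rewrite divr_ge0// ltW.
  have /andP[_ h] := truncn_itv dr.
  apply: (lt_trans h); rewrite -natrX ltr_nat ltn_expl//.
(* Position of [t] in units of the mesh; its integer part gives the grid point just left of [t],
   within the continuity radius [r]. *)
pose y := (t - a) / dl * 2 ^+ k.
have y0 : 0 <= y by rewrite mulr_ge0 ?divr_ge0 ?(ltW dl0) ?subr_ge0.
have /andP[jy yj] := truncn_itv y0; set j := Num.truncn y in jy yj.
have two0 : 0 < 2 ^+ k :> R by rewrite exprn_gt0.
have jk : (j <= 2 ^ k)%N.
  rewrite -(ler_nat R) natrX (le_trans jy)// ler_piMl ?(ltW two0)//.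
  by rewrite ler_pdivrMr// mul1r lerBlDl.
have near_t : ball t r (dyadic a dl k j).
  have tE : t - dyadic a dl k j = dl / 2 ^+ k * (y - j%:R).
    by rewrite /dyadic /y; field; rewrite !gt_eqF.
  rewrite /ball/= tE normrM ger0_norm; last by rewrite divr_ge0 ?ltW.
  rewrite ger0_norm ?subr_ge0//.
  apply: (@le_lt_trans _ _ (dl / 2 ^+ k)).
    rewrite ler_piMr ?divr_ge0 ?(ltW dl0) ?(ltW two0)//.
    by rewrite lerBlDl natr1 ltW.
  by rewrite ltr_pdivrMr// mulrC -ltr_pdivrMr.
have := Hr _ near_t => /= h.
apply: le_trans (ler_distD (f (dyadic a dl k j)) _ _) _.
rewrite [leRHS]addrC; apply: lerD; first exact: ltW.
by apply: le_trans (dyadic_chain H jk) _; exact: cC.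
Qed.

End Dyadic.

(** * Oscillation of [B_n] over a short interval *)

Section Oscillation.
Context {R : realType} {d : measure_display} {T : measurableType d}.
Variables (P : probability T R) (v : R -> R) (A : nat -> R -> T -> R) (G : R).
Hypotheses (v0 : v 0 = 0) (iidA : iid_gaussian_copies P v A).
Hypotheses (G0 : 0 < G) (vG : forall u, 0 <= u -> v u <= (G * u) ^+ 2).
Implicit Types (n k j : nat) (a x y dl eta K : R) (w : T).

Local Notation agg := (agg A).

Lemma quad3_increment x y z : 0 <= x -> 0 <= y ->
  quad3 v 1 (-1) 0 x y z = v `|x - y|.
Proof.
by move=> x0 y0; rewrite /quad3 /Gam (ger0_norm x0) (ger0_norm y0) (distrC y x); field.
Qed.

Lemma agg_increment_tail n x y h u : (0 < n)%N -> 0 <= x -> 0 <= y -> 0 < h ->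
  `|x - y| <= h -> 0 <= u ->
  (P [set w | (n%:R * u <= 1 * agg n x w + (-1) * agg n y w + 0 * agg n x w)%R] <=
    (expR (- (n%:R * (u ^+ 2 / (2 * (G * h) ^+ 2)))))%:E)%E.
Proof.
move=> n0 x0 y0 h0 xyh u0; apply: (agg3_tail_le v0 iidA) => //.
  rewrite quad3_increment// (le_trans (vG _))//.
  by rewrite ler_sqr ?nnegrE ?mulr_ge0 ?(ltW G0) ?(ltW h0)// ler_pM2l.
by rewrite exprn_gt0// mulr_gt0.
Qed.

(** The thresholds [eta (3/4)^k / 4] sum to [eta], yet decay more slowly than the standard
    deviations, of order [2^-k]. The rate at level [k] thus grows like [(9/4)^k >= k + 1]; the
    factor 32 is [2 * 4^2]. *)
Lemma osc_level_rate (K eta dl : R) k : 0 < dl -> 0 <= K ->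
  32 * K * (G * dl) ^+ 2 <= eta ^+ 2 ->
  K * k.+1%:R <= (eta * (3 / 4) ^+ k / 4) ^+ 2 / (2 * (G * (dl / 2 ^+ k)) ^+ 2).
Proof.
move=> dl0 K0 H.
have -> : (eta * (3 / 4) ^+ k / 4) ^+ 2 / (2 * (G * (dl / 2 ^+ k)) ^+ 2) =
    eta ^+ 2 / (32 * (G * dl) ^+ 2) * (9 / 4) ^+ k.
  have -> : (9 / 4 : R) = ((3 / 4) * 2) ^+ 2 by field.
  rewrite -exprM mulnC exprM [(_ * 2) ^+ k]exprMn.
  set p := (3 / 4) ^+ k.
  by field; rewrite !gt_eqF// exprn_gt0.
apply: ler_pM => //.
  rewrite ler_pdivlMr ?mulr_gt0 ?exprn_gt0// ?mulr_gt0//.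
  by rewrite mulrCA mulrA.
elim: k => [|k IH]; first by rewrite expr0.
rewrite exprS (le_trans _ (ler_wpM2l _ IH))//.
have := ler0n R k; rewrite -(natr1 k.+1) -(natr1 k); lra.
Qed.

(** With [K >= 3] one has [expR (- n K) <= 1/4], so level [k] costs [expR (- n K) 4^-k] per interval
    and sign. This beats the [2^k] intervals, and the total is [2 * 2 * expR (- n K)]. *)
Lemma agg_osc n a dl eta K : (0 < n)%N -> 0 <= a -> 0 < dl -> 0 <= eta -> 3 <= K ->
  32 * K * (G * dl) ^+ 2 <= eta ^+ 2 ->
  exists M, [/\ measurable M, (P M <= (4 * expR (- (n%:R * K)))%:E)%E &
    forall w, ~ M w -> forall t, a <= t -> t <= a + dl ->
      `|agg n t w - agg n a w| <= n%:R * eta].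
Proof.
move=> n0 a0 dl0 eta0 K3 H.
have K0 : 0 <= K by apply: le_trans K3.
pose c k : R := eta * (3 / 4) ^+ k / 4.
have c0 k : 0 <= c k by rewrite !mulr_ge0// exprn_ge0// divr_ge0.
pose x k j := dyadic a dl k j.
have x0 k j : 0 <= x k j.
  by rewrite addr_ge0// mulr_ge0 ?(ltW dl0)// mulr_ge0// invr_ge0 exprn_ge0.
pose E x y k := [set w | (n%:R * c k <=
  1 * agg n x w + (-1) * agg n y w + 0 * agg n x w)%R].
pose F k j := E (x k j.+1) (x k j) k `|` E (x k j) (x k j.+1) k.
have mE y z k : measurable (E y z k) by exact: (measurable_agg3_ge iidA).
have mF k j : measurable (F k j) by exact: measurableU.
have nK4 : expR (- (n%:R * K)) <= 4^-1.
  rewrite expRN lef_pV2 ?posrE ?expR_gt0//.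
  apply: le_trans (expR_ge1Dx _).
  have : 1 * 3 <= n%:R * K by apply: ler_pM => //; rewrite ler1n.
  lra.
have PF k j : (P (F k j) <= (2 * (expR (- (n%:R * K)) * 4^-1 ^+ k))%:E)%E.
  have -> : 2 * (expR (- (n%:R * K)) * 4^-1 ^+ k) =
    expR (- (n%:R * K)) * 4^-1 ^+ k + expR (- (n%:R * K)) * 4^-1 ^+ k by ring.
  have xx : `|x k j.+1 - x k j| <= dl / 2 ^+ k.
    rewrite /x /dyadic -natr1.
    rewrite (_ : _ - _ = dl / 2 ^+ k); last by field; rewrite expf_neq0.
    by rewrite ger0_norm// divr_ge0 ?(ltW dl0)// exprn_ge0.
  have PE y z : 0 <= y -> 0 <= z -> `|y - z| <= dl / 2 ^+ k ->
     (P (E y z k) <= (expR (- (n%:R * K)) * 4^-1 ^+ k)%:E)%E.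
    move=> y0 z0 yz.
    apply: (le_trans (agg_increment_tail n0 y0 z0 _ yz (c0 k))).
      by rewrite divr_gt0// exprn_gt0.
    rewrite lee_fin.
    apply: (@le_trans _ _ (expR (- (n%:R * (K * k.+1%:R))))).
      by rewrite ler_expR lerN2 ler_wpM2l// osc_level_rate.
    rewrite mulrA -mulNr [in leLHS]mulrC expRM_natl exprS.
    rewrite ler_wpM2l ?expR_ge0//.
    by apply: lerXn2r; rewrite ?nnegrE ?expR_ge0// ?invr_ge0.
  apply: probability_le_setU => //.
    exact: PE.
  by apply: PE => //; rewrite distrC.
exists (\bigcup_k \bigcup_(j < 2 ^ k) F k j); split.
- by apply: bigcupT_measurable => k; apply: bigcup_measurable => j _.
- pose u k : R := 2 * expR (- (n%:R * K)) * 2^-1 ^+ k.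
  apply: (@probability_bigcup_le _ _ _ _ _ u).
  + by move=> k; apply: bigcup_measurable => j _.
  + move=> k; apply: (le_trans (probability_bigcup_fin_le (2 ^ k) (mF k) (PF k))).
    rewrite lee_fin natrX /u le_eqVlt; apply/orP; left; apply/eqP.
    rewrite (_ : 4^-1 = 2^-1 * 2^-1 :> R); last by field.
    rewrite exprMn exprVn; field.
    by rewrite expf_neq0.
  + move=> N; rewrite -mulr_sumr.
    have -> : 4 * expR (- (n%:R * K)) = 2 * expR (- (n%:R * K)) * 2 by ring.
    rewrite ler_wpM2l ?mulr_ge0 ?expR_ge0//.
    suff : \sum_(i < N) 2^-1 ^+ i = 2 - 2 * 2^-1 ^+ N :> R.
      move=> ->; rewrite gerBl mulr_ge0// exprn_ge0// invr_ge0//.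
    elim: N => [|N IH]; first by rewrite big_ord0 expr0 mulr1 subrr.
    by rewrite big_ord_recr/= IH exprS; field.
- move=> w nM t at_ tdl.
  apply: (@dyadic_chain_continuous _ (fun t => agg n t w) a dl
    (fun k => n%:R * c k)) => //.
  + exact: (continuous_agg iidA).
  + move=> k j jk; rewrite leNgt; apply/negP => h; apply: nM.
    exists k => //; exists j => //.
    case: (leP 0 (agg n (x k j.+1) w - agg n (x k j) w)) => s.
      left; move: h; rewrite ger0_norm// /E/= => /ltW.
      by rewrite mul1r mulN1r mul0r addr0.
    right; move: h; rewrite ltr0_norm// opprB /E/= => /ltW.
    by rewrite mul1r mulN1r mul0r addr0.
  + move=> k; rewrite -mulr_sumr ler_wpM2l//.
    suff -> : \sum_(i < k) c i = eta * (1 - (3 / 4) ^+ k).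
      by rewrite ler_piMr// gerBl exprn_ge0// divr_ge0.
    elim: k => [|k IH]; first by rewrite big_ord0 expr0 subrr mulr0.
    by rewrite big_ord_recr/= IH /c exprS; field.
Qed.

End Oscillation.

(** * Compactness and exponentially small events *)

Section CompactInduction.
Variable R : realType.

(** Heine-Borel as an induction principle. It serves both for the union over overflow times and for
    the uniform bound on [Ups] near [t0]. *)
Lemma segment_induction (Q : set R -> Prop) (a b : R) :
  (forall S S', S `<=` S' -> Q S' -> Q S) -> Q set0 ->
  (forall S S', Q S -> Q S' -> Q (S `|` S')) ->
  (forall t, a <= t -> t <= b -> exists2 e : R, 0 < e & Q (ball t e)) ->
  Q `[a, b]%classic.
Proof.
move=> QS Q0 QU Qloc.
(* [choice] asks for a radius at every real; outside [[a, b]] it is the dummy value 1. *)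
have /choice[e He] : forall t, exists e : R, 0 < e /\ (a <= t -> t <= b -> Q (ball t e)).
  move=> t; have [/andP[at_ tb]|h] := boolP (a <= t <= b).
    by have [e e0 Qe] := Qloc t at_ tb; exists e; split.
  by exists 1; split => // at_ tb; rewrite at_ tb in h.
have := @segment_compact R a b; rewrite compact_cover.
move=> /(_ R `[a, b]%classic (fun t => ball t (e t))).
case.
- by move=> t _; apply: ball_open; have [] := He t.
- move=> t tab; exists t => //; apply: ballxx; by have [] := He t.
move=> D DI cov; apply: QS cov _.
rewrite /cover bigcup_fset big_seq; elim/big_ind : _ => // i /DI.
by rewrite inE/= in_itv/= => /andP[ai ib]; exact: (He i).2.
Qed.

End CompactInduction.

Section ExpSmall.
Context {R : realType} {d : measure_display} {T : measurableType d}.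
Variable P : probability T R.
Implicit Types (E F : nat -> set T) (x y : R).

(* An outer-measure bound, so that [E n] itself need not be measurable. *)
Definition exp_small E x := exists2 C : R, 0 <= C & forall n, (0 < n)%N ->
  exists M, [/\ measurable M, E n `<=` M & (P M <= (C * expR (- (n%:R * x)))%:E)%E].

Lemma exp_smallS E F x : (forall n, (0 < n)%N -> E n `<=` F n) ->
  exp_small F x -> exp_small E x.
Proof.
move=> EF [C C0 H]; exists C => // n n0; have [M [mM FM PM]] := H n n0.
by exists M; split => //; apply: subset_trans FM; exact: EF.
Qed.

Lemma exp_small_le E x y : x <= y -> exp_small E y -> exp_small E x.
Proof.
move=> xy [C C0 H]; exists C => // n n0; have [M [mM EM PM]] := H n n0.
exists M; split => //; apply: le_trans PM _.
by rewrite lee_fin ler_wpM2l// ler_expR lerN2 ler_wpM2l.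
Qed.

Lemma exp_small0 x : exp_small (fun=> set0) x.
Proof.
by exists 0 => // n _; exists set0; split => //; rewrite measure0 mul0r.
Qed.

Lemma exp_smallU E F x : exp_small E x -> exp_small F x ->
  exp_small (fun n => E n `|` F n) x.
Proof.
move=> [C C0 H] [D D0 H']; exists (C + D); first exact: addr_ge0.
move=> n n0; have [M [mM EM PM]] := H n n0; have [N [mN FN PN]] := H' n n0.
exists (M `|` N); split; [exact: measurableU|exact: setUSS|].
by rewrite mulrDl; exact: probability_le_setU.
Qed.

Lemma exp_small_bigcup (N : nat) (E : nat -> nat -> set T) x :
  (forall j, (j < N)%N -> exp_small (E j) x) ->
  exp_small (fun n => \bigcup_(j < N) E j n) x.
Proof.
elim: N => [|N IH] H; first by apply: exp_smallS (exp_small0 x) => n _ w [].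
have EN := H N (ltnSn N).
have /IH EI : forall j, (j < N)%N -> exp_small (E j) x.
  by move=> j jN; apply: H; exact: ltnW.
apply: exp_smallS (exp_smallU EI EN) => n _ w [j /=].
rewrite ltnS leq_eqVlt => /orP[/eqP-> Ew|jN Ew]; [by right|left].
by exists j.
Qed.

End ExpSmall.

(** * Growth of the variance at infinity *)

Section Tail.
Variable R : realType.

(** Telescoping: [1 / (j+2)^2 <= 1 / (j+1) - 1 / (j+2)]. *)
Lemma sum_invsqr_le1 (N : nat) : \sum_(j < N) (j.+2%:R ^+ 2)^-1 <= 1 - N.+1%:R^-1 :> R.
Proof.
elim: N => [|N IH]; first by rewrite big_ord0 invr1 subrr.
rewrite big_ord_recr/= (le_trans (lerD IH (lexx _)))//.
have x0 : 0 < N.+1%:R :> R by rewrite ltr0n.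
rewrite -(natr1 N.+1); move: N.+1%:R x0 => x x0.
rewrite -subr_ge0 (_ : _ - _ = (x * (x + 1) ^+ 2)^-1); last first.
  by field; rewrite !gt_eqF//; lra.
by rewrite invr_ge0 mulr_ge0 ?sqr_ge0// ltW.
Qed.

(** Since [v t <= t^al] eventually, [t^2 / v t] is at least [y^2] with [y = t^((2 - al) / 2)], while
    [ln t] is at most a multiple of [y]. The term [2 ln t] pays for a union over integer blocks
    through a factor [k^-2]. *)
Lemma variance_ln_bound (v : R -> R) (c K : R) : variance_fun v -> 0 < c ->
  exists2 T1 : R, 0 < T1 & forall t, T1 <= t -> 8 * (K + 2 * ln t) * v t <= (c * t) ^+ 2.
Proof.
move=> [v0 _ _ [al [al2 vlim]]] c0.
pose be := 2 - al; have be0 : 0 < be by rewrite subr_gt0.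
have [T0 [T0r HT0]] : \forall t \near +oo, `|v t / t `^ al| < 1.
  by have /cvgr0Pnorm_lt/(_ 1 ltr01) := vlim.
(* Once [y >= Y], the linear bound [(8 |K| + 32 / be) y] on the left side is absorbed by
   [c^2 y^2]. *)
pose Y : R := 1 + (8 * `|K| + 32 / be) / c ^+ 2.
have nu0 : 0 <= 8 * `|K| + 32 / be.
  by apply: addr_ge0; [rewrite mulr_ge0|rewrite divr_ge0 ?(ltW be0)].
have Y1 : 1 <= Y by rewrite lerDl divr_ge0 ?sqr_ge0.
have Y0 : 0 < Y by apply: lt_le_trans Y1.
exists (`|T0| + 1 + Y `^ (2 / be)).
  by rewrite ltr_wpDr ?powR_ge0// ltr_wpDl.
move=> t Tt.
have t1 : 1 <= t.
  by apply: le_trans Tt; rewrite (addrC _ 1) -addrA lerDl addr_ge0 ?powR_ge0.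
have t0 : 0 < t by apply: lt_le_trans t1.
have tT0 : T0 < t.
  apply: lt_le_trans Tt; apply: le_lt_trans (ler_norm _) _.
  by rewrite -addrA ltrDl ltr_wpDr ?powR_ge0.
have vt : v t <= t `^ al.
  have := HT0 _ tT0; have pt : 0 < t `^ al by exact: powR_gt0.
  rewrite ger0_norm; last by rewrite divr_ge0 ?v0 ?ltW.
  by rewrite ltr_pdivrMr// mul1r => /ltW.
pose y := t `^ (be / 2).
have yY : Y <= y.
  have -> : Y = (Y `^ (2 / be)) `^ (be / 2).
    rewrite -powRrM (_ : 2 / be * (be / 2) = 1) ?powRr1 ?(ltW Y0)//.
    by field; rewrite gt_eqF.
  apply: ge0_ler_powR; rewrite ?nnegrE ?divr_ge0 ?(ltW be0) ?powR_ge0 ?(ltW t0)//.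
  by apply: le_trans Tt; rewrite lerDr addr_ge0.
have y1 : 1 <= y by apply: le_trans yY.
have y0 : 0 < y by apply: lt_le_trans y1.
have lnt : ln t <= 2 / be * y.
  have /ltW := ln_sublinear y0; rewrite /y ln_powR => h.
  have -> : ln t = 2 / be * (be / 2 * ln t) by field; rewrite gt_eqF.
  by rewrite ler_pM2l// divr_gt0.
have t2 : t ^+ 2 = t `^ al * y ^+ 2.
  rewrite -(powR_mulrn 2 (ltW t0)) -(powR_mulrn 2 (ltW y0)) /y -powRrM -powRD.
    by congr (_ `^ _); rewrite /be; field.
  by rewrite (gt_eqF t0) implybT.
have lnt0 : 0 <= ln t by exact: ln_ge0.
have [KK|KK] := leP 0 (K + 2 * ln t); last first.
  apply: (@le_trans _ _ 0); last exact: sqr_ge0.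
  by rewrite mulr_le0_ge0 ?v0 ?(ltW t0)// mulr_ge0_le0// ltW.
apply: (@le_trans _ _ (8 * (K + 2 * ln t) * t `^ al)).
  by rewrite ler_wpM2l// mulr_ge0.
rewrite exprMn t2 [leRHS]mulrCA [leLHS]mulrC ler_wpM2l ?powR_ge0//.
apply: (@le_trans _ _ ((8 * `|K| + 32 / be) * y)).
  have h1 : K <= `|K| * y by rewrite (le_trans (ler_norm _))// ler_peMr.
  have -> : (8 * `|K| + 32 / be) * y = 8 * (`|K| * y + 2 * (2 / be * y)) by ring.
  by rewrite ler_pM2l//; lra.
rewrite expr2 mulrA ler_wpM2r ?(ltW y0)//.
have : Y * c ^+ 2 <= y * c ^+ 2 by rewrite ler_wpM2r ?sqr_ge0.
rewrite /Y mulrDl divfK ?sqrf_eq0 ?gt_eqF//.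
have := sqr_ge0 c; lra.
Qed.
End Tail.

(** * Exponential rates: long times, and overflow near a given time *)

Section Rates.
Context {R : realType} {d : measure_display} {T : measurableType d}.
Variables (P : probability T R) (v : R -> R) (A : nat -> R -> T -> R) (G : R).
Hypotheses (vF : variance_fun v) (iidA : iid_gaussian_copies P v A).
Hypotheses (G0 : 0 < G) (vG : forall u, 0 <= u -> v u <= (G * u) ^+ 2).
Hypothesis vgt0 : forall t, 0 < t -> 0 < v t.
Implicit Types (n k j : nat) (s t x K : R) (w : T).

Local Notation agg := (agg A).

Let v0 : v 0 = 0. Proof. by case: vF. Qed.

(** To reach [c t] in the block, the process must exceed [c k / 2] at [k] or oscillate by more than
    [c k / 4]; the two growth hypotheses give these events the rate [K + 2 ln k]. The constant 5 is
    4 for chaining plus 1 for the half-space. *)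
Lemma agg_tail_block n k (c K : R) : (0 < n)%N -> (2 <= k)%N -> 0 < c -> 3 <= K ->
  8 * (K + 2 * ln k%:R) * v k%:R <= (c * k%:R) ^+ 2 ->
  32 * (K + 2 * ln k%:R) * G ^+ 2 <= (c * k%:R / 4) ^+ 2 ->
  exists M, [/\ measurable M,
    (P M <= (5 * expR (- (n%:R * K)) * (k%:R ^+ 2)^-1)%:E)%E &
    forall w, ~ M w -> forall t, k%:R <= t -> t <= k%:R + 1 -> agg n t w < n%:R * (c * t)].
Proof.
move=> n0 k2 c0 K3 kv kG.
have k1 : 1 <= k%:R :> R by rewrite ler1n (leq_trans _ k2).
have k0 : 0 < k%:R :> R by apply: lt_le_trans k1.
have n0' : 0 < n%:R :> R by rewrite ltr0n.
have lnk : 0 <= ln k%:R :> R by exact: ln_ge0.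
pose Kk := K + 2 * ln k%:R.
have [M1 [mM1 PM1 HM1]] : exists M, [/\ measurable M, (P M <= (4 * expR (- (n%:R * Kk)))%:E)%E &
    forall w, ~ M w -> forall t, k%:R <= t -> t <= k%:R + 1 ->
      `|agg n t w - agg n k%:R w| <= n%:R * (c * k%:R / 4)].
  apply: (agg_osc v0 iidA G0 vG) => //.
  - by rewrite divr_ge0 ?mulr_ge0 ?(ltW c0).
  - by rewrite (le_trans K3)// lerDl mulr_ge0.
  - by rewrite mulr1.
pose M2 := [set w | (n%:R * (c * k%:R / 2) <=
  1 * agg n k%:R w + 0 * agg n k%:R w + 0 * agg n k%:R w)%R].
have mM2 : measurable M2 by exact: (measurable_agg3_ge iidA).
have vk := vgt0 k0.
have PM2 : (P M2 <= (expR (- (n%:R * Kk)))%:E)%E.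
  have := @agg3_tail_le _ _ _ P v A v0 iidA n 1 0 0 k%:R k%:R k%:R (v k%:R) (c * k%:R / 2).
  move=> /(_ (ltW k0) (ltW k0) (ltW k0) n0).
  rewrite /quad3 (_ : _ <= _ = true); last by apply/idP; lra.
  rewrite divr_ge0 ?mulr_ge0 ?(ltW c0)// => /(_ isT vk isT) /le_trans; apply.
  rewrite lee_fin ler_expR lerN2 ler_pM2l// ler_pdivlMr ?mulr_gt0//.
  rewrite (_ : (c * k%:R / 2) ^+ 2 = (c * k%:R) ^+ 2 / 4); last by field.
  rewrite ler_pdivlMr//.
  by apply: le_trans kv; rewrite /Kk le_eqVlt; apply/orP; left; apply/eqP; ring.
have ek : expR (- (n%:R * Kk)) <= expR (- (n%:R * K)) * (k%:R ^+ 2)^-1.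
  rewrite /Kk mulrDr opprD expRD ler_wpM2l ?expR_ge0//.
  rewrite -[leRHS]lnK ?posrE ?invr_gt0 ?exprn_gt0// ler_expR lnV ?posrE ?exprn_gt0//.
  rewrite lnXn// lerN2 -(mulr_natl (ln _)) ler_peMl ?mulr_ge0//.
  by rewrite ler1n.
exists (M1 `|` M2); split.
- exact: measurableU.
- apply: (le_trans (probability_le_setU mM1 mM2 PM1 PM2)).
  rewrite lee_fin -mulrA; lra.
move=> w nM t kt tk; rewrite ltNge; apply/negP => h.
have := HM1 w (fun h => nM (or_introl h)) t kt tk.
rewrite ler_norml => /andP[_ h1].
apply: nM; right; rewrite /M2/= mul1r !mul0r !addr0.
have : n%:R * (c * k%:R) <= n%:R * (c * t) by rewrite !ler_pM2l.
have : 0 <= n%:R * (c * k%:R) by rewrite !mulr_ge0// ltW.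
rewrite !mulrA in h h1 *.
lra.
Qed.

Lemma agg_tail (c K : R) : 0 < c -> exists2 T1 : R, 0 < T1 &
  exp_small P (fun n => [set w | exists2 t, T1 <= t & n%:R * (c * t) <= agg n t w]) K.
Proof.
move=> c0; pose K' := Num.max K 3.
have K'3 : 3 <= K' by rewrite le_max lexx orbT.
have K'0 : 0 <= K' by apply: le_trans K'3.
have [T0 T00 HT0] := variance_ln_bound K' vF c0.
(* For [k >= K'] one has [K' + 2 ln k <= 3 k], so the chaining condition follows from
   [96 G^2 k <= (c k / 4)^2], that is [k >= gc]. *)
pose gc : R := 96 * G ^+ 2 / (c / 4) ^+ 2.
have gc0 : 0 <= gc by apply: divr_ge0; [apply: mulr_ge0|]; rewrite ?sqr_ge0.
pose X : R := T0 + K' + gc.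
have X3 : 3 <= X.
  by rewrite /X; move: T00 K'3 gc0; lra.
have /andP[_ XN] := truncn_itv (le_trans (ler0n R 3) X3).
pose N := (Num.truncn X).+1; rewrite -/N in XN.
have N2 : (2 <= N)%N by rewrite -(ler_nat R); lra.
exists N%:R; first by rewrite ltr0n (leq_trans _ N2).
apply: (@exp_small_le _ _ _ _ _ K K'); first by rewrite le_max lexx.
exists 5 => // n n0.
have blk j : exists M, [/\ measurable M,
    (P M <= (5 * expR (- (n%:R * K')) * ((N + j)%:R ^+ 2)^-1)%:E)%E &
    forall w, ~ M w -> forall t, (N + j)%:R <= t -> t <= (N + j)%:R + 1 ->
      agg n t w < n%:R * (c * t)].
  have kX : X <= (N + j)%:R.
    by apply: (le_trans (ltW XN)); rewrite ler_nat leq_addr.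
  set k := (N + j)%N in kX *.
  have k0 : 0 < k%:R :> R by lra.
  apply: agg_tail_block => //; first by rewrite (leq_trans N2)// leq_addr.
    apply: HT0; apply: le_trans kX; by rewrite /X -addrA lerDl addr_ge0.
  have lnk := ltW (ln_sublinear k0).
  have Kk : K' <= k%:R.
    apply: le_trans kX; by rewrite /X addrAC lerDr addr_ge0 ?(ltW T00).
  apply: (@le_trans _ _ (96 * G ^+ 2 * k%:R)).
    have : 0 <= G ^+ 2 by exact: sqr_ge0.
    move: (G ^+ 2) => g g0.
    have : g * (K' + 2 * ln k%:R) <= g * (3 * k%:R) by rewrite ler_wpM2l//; lra.
    lra.
  rewrite (_ : (c * k%:R / 4) ^+ 2 = (c / 4) ^+ 2 * k%:R * k%:R); last by field.
  rewrite ler_pM2r// -ler_pdivrMl; last first.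
    by rewrite exprn_gt0// divr_gt0.
  rewrite mulrC.
  by apply: le_trans kX; rewrite /X lerDr addr_ge0// ltW.
have [M HM] := choice blk.
exists (\bigcup_j M j); split.
- by apply: bigcupT_measurable => j; have [] := HM j.
- move=> w [t Nt ht].
  have t0 : 0 <= t by apply: le_trans Nt.
  have /andP[kt tk] := truncn_itv t0; set k := Num.truncn t in kt tk.
  have Nk : (N <= k)%N by rewrite /k truncn_ge_nat.
  apply: contrapT => nM.
  have [_ _ /(_ w)] := HM (k - N)%N.
  have nMk : ~ M (k - N)%N w by move=> Mw; apply: nM; exists (k - N)%N.
  rewrite subnKC// natr1 => /(_ nMk t kt (ltW tk)).
  by rewrite ltNge ht.
- apply: (@probability_bigcup_le _ _ _ _ _
    (fun j => 5 * expR (- (n%:R * K')) * (j.+2%:R ^+ 2)^-1)).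
  + by move=> j; have [] := HM j.
  + move=> j; have [_ h _] := HM j; apply: le_trans h _.
    rewrite lee_fin ler_wpM2l ?mulr_ge0 ?expR_ge0//.
    have Nj : (j.+2 <= N + j)%N by rewrite -addn2 addnC leq_add2r.
    have Nj0 : (0 < N + j)%N by apply: leq_trans Nj.
    rewrite lef_pV2 ?posrE ?exprn_gt0 ?ltr0n//.
    by rewrite ler_sqr ?nnegrE// ler_nat.
  + move=> m; rewrite -mulr_sumr ler_piMr ?mulr_ge0 ?expR_ge0//.
    by apply: (le_trans (sum_invsqr_le1 R m)); rewrite gerBl invr_ge0.
Qed.

Section Overflow.
Variables (b c1 c2 : R).

Definition overflow n t w : Prop :=
  n%:R * (b + c2 * t) <= agg n t w /\
  forall s, 0 < s -> n%:R * (b + c2 * t - c1 * s) <= agg n t w - agg n s w.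

(* The half-space [al * A(-t,0) + be * A(-t,-s) >= L] contains the overflow paths at time [t]. *)
Lemma overflow_local t s al be x : 0 < c2 -> 0 < t -> 0 < s -> 0 <= al -> 0 <= be ->
  let L := al * (b + c2 * t) + be * (b + c2 * t - c1 * s) in
  let q := quad3 v (al + be) (- be) 0 t s t in
  0 < L -> 0 < q -> 2 * x * q < L ^+ 2 ->
  exists2 e : R, 0 < e &
    exp_small P (fun n => [set w | exists2 t', ball t e t' & overflow n t' w]) x.
Proof.
move=> c20 t0 s0 al0 be0 L q L0 q0 xqL.
pose D := L ^+ 2 - 2 * x * q; have D0 : 0 < D by rewrite subr_gt0.
(* The loss allowed on [L]: [4 L xi <= D] gives [(L - xi)^2 >= L^2 - D = 2 x q], and [xi <= L / 2]
   keeps the level positive. *)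
pose xi := Num.min (L / 2) (D / (4 * L)).
have xi0 : 0 < xi by rewrite lt_min !divr_gt0// mulr_gt0.
have xiL : xi <= L / 2 by rewrite ge_min lexx.
have xiD : 4 * (L * xi) <= D.
  have : xi <= D / (4 * L) by rewrite ge_min lexx orbT.
  by rewrite ler_pdivlMr ?mulr_gt0// => h; apply: le_trans h; lra.
pose eta := xi / (3 * (al + be + 1)).
have ab0 : 0 < al + be + 1 by rewrite ltr_wpDl// addr_ge0.
have eta0 : 0 < eta by rewrite divr_gt0// mulr_gt0.
have [K [K3 xK]] : exists K, 3 <= K /\ x <= K.
  by exists (Num.max x 3); rewrite !le_max !lexx orbT.
have K0 : 0 < K by apply: lt_le_trans K3.
(* [s] stays fixed while the overflow time moves, so only oscillations near [t] matter. The three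
   bounds keep the window in positive times, the drift below [eta], and the oscillation over length
   [2 e] below [eta] at rate [K]. *)
pose e := Num.min t (Num.min (eta / c2) (eta / (16 * K * G))).
have e0 : 0 < e by rewrite !lt_min t0 !divr_gt0// !mulr_gt0.
have et : e <= t by rewrite !ge_min lexx.
have ec : c2 * e <= eta.
  have : e <= eta / c2 by rewrite !ge_min lexx !orbT.
  by rewrite ler_pdivlMr// mulrC.
have eG : 16 * K * G * e <= eta.
  have : e <= eta / (16 * K * G) by rewrite !ge_min lexx !orbT.
  by rewrite ler_pdivlMr ?mulr_gt0// mulrC.
have abx : (al + be) * (c2 * e + 2 * eta) <= xi.
  apply: (@le_trans _ _ ((al + be + 1) * (3 * eta))).
    have ce0 : 0 <= c2 * e by rewrite mulr_ge0// ltW.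
    by apply: ler_pM; move: al0 be0 ec eta0 ce0; lra.
  rewrite le_eqVlt; apply/orP; left; apply/eqP; rewrite /eta; field.
  by rewrite gt_eqF.
exists e => //; exists 5 => // n n0.
have n0' : 0 < n%:R :> R by rewrite ltr0n.
have [M1 [mM1 PM1 HM1]] : exists M, [/\ measurable M, (P M <= (4 * expR (- (n%:R * K)))%:E)%E &
    forall w, ~ M w -> forall t', t - e <= t' -> t' <= t - e + 2 * e ->
      `|agg n t' w - agg n (t - e) w| <= n%:R * eta].
  apply: (agg_osc v0 iidA G0 vG) => //.
  - by rewrite subr_ge0.
  - by rewrite mulr_gt0.
  - exact: ltW.
  - have h : (16 * K * G * e) ^+ 2 <= eta ^+ 2.
      by rewrite ler_sqr ?nnegrE ?(ltW eta0)// !mulr_ge0// ltW.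
    apply: le_trans h.
    have -> : 32 * K * (G * (2 * e)) ^+ 2 = 32 * 4 * (K * (G * e) ^+ 2) by ring.
    have -> : (16 * K * G * e) ^+ 2 = 16 * 16 * K * (K * (G * e) ^+ 2) by ring.
    by apply: ler_wpM2r; [apply: mulr_ge0; [exact: ltW|exact: sqr_ge0]|lra].
pose M2 := [set w | (n%:R * (L - xi) <=
  (al + be) * agg n t w + (- be) * agg n s w + 0 * agg n t w)%R].
have mM2 : measurable M2 by exact: (measurable_agg3_ge iidA).
have PM2 : (P M2 <= (expR (- (n%:R * x)))%:E)%E.
  have := @agg3_tail_le _ _ _ P v A v0 iidA n (al + be) (- be) 0 t s t q (L - xi).
  move=> /(_ (ltW t0) (ltW s0) (ltW t0) n0 (lexx _) q0).
  rewrite (_ : 0 <= L - xi = true); last by apply/idP; lra.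
  move=> /(_ isT) /le_trans; apply.
  rewrite lee_fin ler_expR lerN2 ler_pM2l// ler_pdivlMr ?mulr_gt0//.
  have -> : (L - xi) ^+ 2 = L ^+ 2 - 2 * (L * xi) + xi ^+ 2 by ring.
  have := sqr_ge0 xi; have : 0 <= L * xi by rewrite mulr_ge0// ltW.
  move: xiD; rewrite /D; lra.
exists (M1 `|` M2); split.
- exact: measurableU.
- move=> w [t' tt' [ov1 ov]]; have ov2 := ov s s0; apply: contrapT => nM.
  have h t1 : `|t - t1| < e -> `|agg n t1 w - agg n (t - e) w| <= n%:R * eta.
    by rewrite ltr_distlC => /andP[? ?]; apply: HM1; [by move=> ?; apply: nM; left| |]; lra.
  have ht : `|agg n t w - agg n (t - e) w| <= n%:R * eta by apply: h; rewrite subrr normr0.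
  have ht' : `|agg n t' w - agg n (t - e) w| <= n%:R * eta by apply: h.
  have {ht ht'} h1 : agg n t' w - agg n t w <= 2 * (n%:R * eta).
    by move: ht ht'; rewrite !ler_norml => /andP[? ?] /andP[? ?]; lra.
  apply: nM; right; rewrite /M2/= mul0r addr0.
  have tt'e : t - e <= t'.
    by move: tt'; rewrite /ball/= ltr_distlC => /andP[? ?]; exact: ltW.
  have ct' : n%:R * (c2 * t - c2 * e) <= n%:R * (c2 * t').
    by rewrite ler_pM2l// -mulrBr ler_pM2l.
  have g1 : n%:R * (b + c2 * t - (c2 * e + 2 * eta)) <= agg n t w by lra.
  have g2 : n%:R * (b + c2 * t - c1 * s - (c2 * e + 2 * eta)) <= agg n t w - agg n s w.
    by lra.
  have := ler_wpM2l al0 g1; have := ler_wpM2l be0 g2 => k2 k1.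
  have : n%:R * ((al + be) * (c2 * e + 2 * eta)) <= n%:R * xi by rewrite ler_pM2l.
  rewrite /L; lra.
- apply: (le_trans (probability_le_setU mM1 mM2 PM1 PM2)).
  rewrite lee_fin.
  have : expR (- (n%:R * K)) <= expR (- (n%:R * x)).
    by rewrite ler_expR lerN2 ler_pM2l.
  lra.
Qed.

End Overflow.
End Rates.

(** * Regularity of the variance and of its square root *)

Section EvenExtension.
Variable R : realType.

(** The even extension turns one-sided continuity at 0 into continuity on the line, which later
    limits use without domain conditions. *)
Lemma continuous_comp_norm (f : R -> R) : {within `[0, +oo[, continuous f} ->
  continuous (fun x : R => f `|x|).
Proof.
move=> /continuous_within_itvcyP[cf cf0] x.
have [->|x0] := eqVneq x 0; last first.
  apply: (cvg_comp (fun x : R => `|x|) f); first exact: (@norm_continuous _ R).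
  by apply: cf; rewrite in_itv/= andbT normr_gt0.
apply/cvgrPdist_lt => e e0; rewrite normr0.
have /cvgrPdist_lt/(_ e e0) := cf0; rewrite near_withinE => /nbhs_ballP[r /= r0 H].
apply/nbhs_ballP; exists r => //= y; rewrite /ball/= sub0r normrN => yr.
have [->|y0] := eqVneq y 0; first by rewrite normr0 subrr normr0.
by apply: H; rewrite /ball/= ?sub0r ?normrN ?normr_id// normr_gt0.
Qed.

End EvenExtension.

Definition sqrtv (R : realType) (v : R -> R) (x : R) : R := Num.sqrt (v x).

Section SqrtVariance.
Variables (R : realType) (v g1 : R -> R).
Local Notation g := (sqrtv v).
Hypotheses (vF : variance_fun v).
Hypotheses (dg : forall t : R, 0 < t -> is_derive t 1 g (g1 t)).
Hypotheses (cg1 : {within `[0, +oo[, continuous g1}).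
Hypotheses (gmono : forall x y : R, 0 <= x -> x < y -> g x < g y).
Hypotheses (gconc : forall x y l : R, 0 <= x -> 0 <= y -> x != y -> 0 < l -> l < 1 ->
          l * g x + (1 - l) * g y < g (l * x + (1 - l) * y)).
Implicit Types s t u x y : R.

Let v0 : v 0 = 0. Proof. by case: vF. Qed.
Let v_ge0 t : 0 <= t -> 0 <= v t. Proof. by case: vF => + _ _ _; apply. Qed.
Let g0 : g 0 = 0. Proof. by rewrite /sqrtv v0 sqrtr0. Qed.

Lemma continuous_v_norm : continuous (fun x : R => v `|x|).
Proof. by apply: continuous_comp_norm; case: vF. Qed.

Lemma continuous_Gam (p : R) : continuous (fun s => Gam v s p).
Proof.
move=> s; apply: cvgM; last exact: cvg_cst.
apply: cvgB; first (apply: cvgD; [exact: continuous_v_norm|exact: cvg_cst]).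
apply: (cvg_comp (fun s : R => p - s) (fun x : R => v `|x|)).
  by apply: cvgB; [exact: cvg_cst|exact: cvg_id].
exact: continuous_v_norm.
Qed.

Lemma sqrtv_sqr t : 0 <= t -> g t ^+ 2 = v t.
Proof. by move=> t0; rewrite sqr_sqrtr// v_ge0. Qed.

Lemma sqrtv_gt0 t : 0 < t -> 0 < g t.
Proof. by move=> t0; have := gmono (lexx 0) t0; rewrite g0. Qed.

Lemma v_gt0 t : 0 < t -> 0 < v t.
Proof. by move=> t0; rewrite -sqrtv_sqr ?ltW// exprn_gt0// sqrtv_gt0. Qed.

Lemma v_lt x y : 0 <= x -> x < y -> v x < v y.
Proof.
move=> x0 xy; have y0 : 0 <= y by rewrite (le_trans x0)// ltW.
by rewrite -!sqrtv_sqr// ltr_sqr ?nnegrE ?sqrtr_ge0// gmono.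
Qed.

(** Concavity between 0 and [t]: the chord slope [g u / u] from the origin decreases. *)
Lemma sqrtv_star u t : 0 < u -> u <= t -> u * g t <= t * g u.
Proof.
move=> u0; rewrite le_eqVlt => /orP[/eqP->//|ut].
have t0 : 0 < t by apply: lt_trans ut.
have := @gconc t 0 (u / t) (ltW t0) (lexx 0).
rewrite gt_eqF// divr_gt0// ltr_pdivrMr// mul1r => /(_ isT isT ut) /ltW.
rewrite !mulr0 g0 !mulr0 !addr0 divfK ?gt_eqF// => h.
by rewrite -ler_pdivrMl// mulrA (mulrC _ u).
Qed.

Lemma continuous_sqrtv_norm : continuous (fun x : R => g `|x|).
Proof.
move=> x; apply: (cvg_comp (fun x : R => v `|x|) Num.sqrt).
  exact: continuous_v_norm.
exact: sqrt_continuous.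
Qed.

Lemma sqrtv_MVT x y : 0 <= x -> x < y ->
  exists c, [/\ x < c, c < y & g y - g x = g1 c * (y - x)].
Proof.
move=> x0 xy.
have dgx c : c \in `]x, y[%R -> is_derive c 1 (fun c : R => g `|c|) (g1 c).
  rewrite in_itv/= => /andP[xc _]; have c0 : 0 < c by apply: le_lt_trans xc.
  have := dg c0; apply: near_eq_is_derive => //.
  near=> z; rewrite ger0_norm//; near: z.
  by near do apply: ltW; exact: lt_nbhsr.
have [] := MVT xy dgx.
  by apply: continuous_subspaceT => z; exact: continuous_sqrtv_norm.
move=> c; rewrite in_itv/= => /andP[xc cy]; rewrite !ger0_norm//; last first.
  by rewrite (le_trans x0)// ltW.
by exists c.
Unshelve. all: by end_near. Qed.

(** Joint limit [s -> 0+], [t -> p]. Here [s] will be the distance to either end of [(0, t)]. *)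
Definition corner (p : R) : set_system (R * R) :=
  within [set z | 0 < z.1] (nbhs ((0 : R), p)).

#[global] Instance corner_filter p : Filter (corner p).
Proof. exact: within_filter. Qed.

Lemma cornerP p (Q : R * R -> Prop) : (\forall z \near corner p, Q z) <->
  exists2 e : R, 0 < e & forall s t, 0 < s -> s < e -> `|t - p| < e -> Q (s, t).
Proof.
rewrite /corner near_withinE; split.
  move=> /nbhs_ballP[e /= e0 H]; exists e => // s t s0 se tp.
  by apply: H => //; split; [rewrite /ball/= sub0r normrN gtr0_norm|
    rewrite /ball/= distrC].
move=> [e e0 H]; apply/nbhs_ballP; exists e => //= -[s t] [/= bs bt] s0.
apply: H => //; last by rewrite distrC.
by move: bs; rewrite /ball/= sub0r normrN gtr0_norm.
Qed.

Lemma slope0_cvg p : (fun z : R * R => g z.1 / z.1) @ corner p --> g1 0.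
Proof.
apply/cvgrPdist_lt => e e0; apply/cornerP.
have /cvgrPdist_lt/(_ e e0) := continuous_comp_norm cg1 (x := 0).
rewrite normr0 => /nbhs_ballP[r /= r0 H]; exists r => // s t s0 sr _ /=.
have [c [c0 cs]] := sqrtv_MVT (lexx 0) s0; rewrite g0 !subr0 => ->.
rewrite mulfK ?gt_eqF//; have := H c; rewrite (gtr0_norm c0); apply.
by rewrite /ball/= sub0r normrN gtr0_norm// (lt_trans cs).
Qed.

Lemma slope_cvg p : 0 < p ->
  (fun z : R * R => (g z.2 - g (z.2 - z.1)) / z.1) @ corner p --> g1 p.
Proof.
move=> p0; apply/cvgrPdist_lt => e e0; apply/cornerP.
have /cvgrPdist_lt/(_ e e0) := continuous_comp_norm cg1 (x := p).
rewrite gtr0_norm// => /nbhs_ballP[r /= r0 H].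
pose r' := Num.min (r / 2) (p / 2).
have r'r : r' <= r / 2 by rewrite ge_min lexx.
have r'p : r' <= p / 2 by rewrite ge_min lexx orbT.
exists r'; first by rewrite lt_min !divr_gt0.
move=> s t s0 sr; rewrite ltr_distl => /andP[pt tp] /=.
have ts0 : 0 <= t - s by lra.
have tst : t - s < t by lra.
have [c [tc ct]] := sqrtv_MVT ts0 tst.
rewrite (_ : t - (t - s) = s); last by ring.
move=> ->; rewrite mulfK ?gt_eqF//; have c0 : 0 < c by lra.
have := H c; rewrite (gtr0_norm c0); apply.
by rewrite /ball/= ltr_distlC; apply/andP; split; lra.
Qed.

(** [g u / u] increases to [g1 0] as [u] decreases to 0. Hence [v u = O(u^2)] with [G = g1 0], the
    constant used in chaining. *)
Lemma sqrtv_le_lin u : 0 <= u -> g u <= g1 0 * u.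
Proof.
rewrite le_eqVlt => /orP[/eqP <-|u0]; first by rewrite g0 mulr0.
rewrite -ler_pdivrMr// leNgt; apply/negP => h.
have /cvgrPdist_lt/(_ (g u / u - g1 0)) := @slope0_cvg 1.
rewrite subr_gt0 => /(_ h)/cornerP[e e0 H].
pose s := Num.min (e / 2) u.
have s0 : 0 < s by rewrite lt_min divr_gt0.
have se : s < e by rewrite gt_min; apply/orP; left; lra.
have su : s <= u by rewrite ge_min lexx orbT.
have := H s 1 s0 se; rewrite subrr normr0 => /(_ e0)/=.
rewrite ltr_distlC => /andP[_]; rewrite addrC subrK ltNge.
by rewrite ler_pdivrMr// mulrAC ler_pdivlMr// mulrC [leRHS]mulrC sqrtv_star.
Qed.

Lemma g1_0_gt0 : 0 < g1 0.
Proof.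
have := sqrtv_le_lin (ler01 : 0 <= 1 :> R); rewrite mulr1.
exact/lt_le_trans/sqrtv_gt0.
Qed.

Lemma v_le_sqr u : 0 <= u -> v u <= (g1 0 * u) ^+ 2.
Proof.
move=> u0; rewrite -sqrtv_sqr// ler_sqr ?nnegrE ?sqrtr_ge0 ?sqrtv_le_lin//.
by rewrite mulr_ge0// ltW// g1_0_gt0.
Qed.

Lemma g1_ge0 p : 0 < p -> 0 <= g1 p.
Proof.
move=> p0; rewrite leNgt; apply/negP => h.
have /cvgrPdist_lt/(_ (- g1 p)) := slope_cvg p0.
rewrite oppr_gt0 => /(_ h)/cornerP[e e0 H].
pose s := Num.min (e / 2) (p / 2).
have s0 : 0 < s by rewrite lt_min !divr_gt0.
have se : s < e by rewrite gt_min; apply/orP; left; lra.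
have sp : s <= p / 2 by rewrite ge_min lexx orbT.
have := H s p s0 se; rewrite subrr normr0 => /(_ e0)/=.
rewrite ltr_distlC => /andP[_]; rewrite subrr ltNge divr_ge0 ?(ltW s0)//.
by rewrite subr_ge0 ltW// gmono//; lra.
Qed.

(** The slope [m] over [[p / 2, p]] separates the two: concavity gives [g1 p <= m], strict concavity
    on [[0, p]] gives [m < g1 0]. Strictness keeps the renormalised conditional variance positive in
    the corner limit. *)
Lemma g1_lt p : 0 < p -> g1 p < g1 0.
Proof.
move=> p0; pose m := (g p - g (p / 2)) / (p / 2).
have p2 : 0 < p / 2 by rewrite divr_gt0.
have h1 : g (p / 2) <= g1 0 * (p / 2) by apply: sqrtv_le_lin; exact: ltW.
have h2 : g p / 2 < g (p / 2).
  have := @gconc p 0 2^-1 (ltW p0) (lexx 0).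
  rewrite gt_eqF// invr_gt0 ltr0n invf_lt1// ltr1n => /(_ isT isT isT).
  by rewrite !mulr0 g0 mulr0 !addr0 mulrC [_^-1 * p]mulrC.
have mlt : m < g1 0 by rewrite /m ltr_pdivrMr//; lra.
apply: le_lt_trans mlt; rewrite leNgt; apply/negP => h.
have /cvgrPdist_lt/(_ (g1 p - m)) := slope_cvg p0.
rewrite subr_gt0 => /(_ h)/cornerP[e e0 H].
pose s := Num.min (e / 2) (p / 4).
have s0 : 0 < s by rewrite lt_min !divr_gt0.
have se : s < e by rewrite gt_min; apply/orP; left; lra.
have sp : s <= p / 4 by rewrite ge_min lexx orbT.
have := H s p s0 se; rewrite subrr normr0 => /(_ e0)/=.
rewrite ltr_distlC => /andP[+ _]; rewrite opprB addrC subrK ltNge.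
rewrite ler_pdivrMr// => /negP; apply.
have sp2 : s / (p / 2) < 1 by rewrite ltr_pdivrMr//; lra.
have := @gconc (p / 2) p (s / (p / 2)) (ltW p2) (ltW p0).
rewrite lt_eqF; last by lra.
rewrite divr_gt0// sp2 => /(_ isT isT isT).
have -> : s / (p / 2) * (p / 2) + (1 - s / (p / 2)) * p = p - s.
  by field; rewrite gt_eqF.
have -> : m * s = s / (p / 2) * (g p - g (p / 2)).
  by rewrite /m; field; rewrite gt_eqF.
lra.
Qed.

Lemma v_ratio_cvg p : (fun z : R * R => v `|z.1| / z.1 ^+ 2) @ corner p --> g1 0 ^+ 2.
Proof.
have h : (fun z : R * R => (g z.1 / z.1) ^+ 2) @ corner p --> g1 0 ^+ 2.
  by rewrite expr2; apply: cvgM; exact: slope0_cvg.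
apply: cvg_trans h; apply: near_eq_cvg; apply/cornerP; exists 1 => // s t s0 _ _ /=.
by rewrite exprMn exprVn sqrtv_sqr ?(ltW s0)// gtr0_norm.
Qed.

Lemma fst_corner_cvg p : (fun z : R * R => z.1) @ corner p --> (0 : R).
Proof. by apply: cvg_within_filter; exact: cvg_fst. Qed.

Lemma snd_corner_cvg p : (fun z : R * R => z.2) @ corner p --> p.
Proof. by apply: cvg_within_filter; exact: cvg_snd. Qed.

(** [2 Gam / s] is [v s / s], which vanishes, plus a difference quotient of [v = g^2], which tends
    to [2 g g1]. *)
Lemma Gam_ratio_cvg p : 0 < p ->
  (fun z : R * R => Gam v z.1 z.2 / z.1) @ corner p --> g p * g1 p.
Proof.
move=> p0.
have gc (f : R * R -> R) (l : R) : 0 < l -> f @ corner p --> l -> (fun z => g `|f z|) @ corner p --> g l.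
  move=> l0 fl; apply: (cvg_comp f (fun x : R => g `|x|)); first exact: fl.
  by have := @continuous_sqrtv_norm l; rewrite /continuous_at (gtr0_norm l0).
have h : (fun z : R * R => (v `|z.1| / z.1 ^+ 2 * z.1 +
   (g z.2 - g (z.2 - z.1)) / z.1 * (g `|z.2| + g `|z.2 - z.1|)) / 2)
   @ corner p --> (g1 0 ^+ 2 * 0 + g1 p * (g p + g p)) / 2.
  apply: cvgM; last exact: cvg_cst.
  apply: cvgD.
    by apply: cvgM; [exact: v_ratio_cvg|exact: fst_corner_cvg].
  apply: cvgM; first exact: slope_cvg.
  apply: cvgD; apply: gc => //; first exact: snd_corner_cvg.
  have : (fun z : R * R => z.2 - z.1) @ corner p --> p - 0.
    by apply: cvgB; [exact: snd_corner_cvg|exact: fst_corner_cvg].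
  by rewrite subr0.
rewrite (_ : g p * g1 p = (g1 0 ^+ 2 * 0 + g1 p * (g p + g p)) / 2); last by field.
apply: cvg_trans h; apply: near_eq_cvg; apply/cornerP; exists (p / 2).
  by rewrite divr_gt0.
move=> s t s0 sp; rewrite ltr_distl => /andP[pt tp] /=.
have t0 : 0 < t by lra.
have ts0 : 0 < t - s by lra.
rewrite /Gam !gtr0_norm//.
rewrite -[v t]sqrtv_sqr ?(ltW t0)// -[v (t - s)]sqrtv_sqr ?(ltW ts0)//.
by field; rewrite gt_eqF.
Qed.

End SqrtVariance.

(** * The function [Ups]: optimal half-spaces, and its behaviour at [t0] *)

Section Upsilon.
Variables (R : realType) (v g1 : R -> R) (b c1 c2 : R).
Local Notation g := (sqrtv v).
Hypotheses (vF : variance_fun v).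
Hypotheses (dg : forall t : R, 0 < t -> is_derive t 1 g (g1 t)).
Hypotheses (cg1 : {within `[0, +oo[, continuous g1}).
Hypotheses (gmono : forall x y : R, 0 <= x -> x < y -> g x < g y).
Hypotheses (gconc : forall x y l : R, 0 <= x -> 0 <= y -> x != y -> 0 < l -> l < 1 ->
          l * g x + (1 - l) * g y < g (l * x + (1 - l) * y)).
Hypotheses (psd : forall a c x y : R, 0 <= x -> 0 <= y -> 0 <= quad3 v a c 0 x y x).
Hypotheses (det_neq0 : forall s t : R, 0 < s -> s < t -> detSigma v s t != 0).
Hypotheses (b0 : 0 < b) (c20 : 0 < c2) (c21 : c2 < c1).
Implicit Types s t u x y : R.

Local Notation t0 := (b / (c1 - c2)).

Let v0 : v 0 = 0. Proof. by case: vF. Qed.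
Let vgt0 t : 0 < t -> 0 < v t. Proof. exact: (v_gt0 vF gmono). Qed.
Let c12 : 0 < c1 - c2. Proof. by rewrite subr_gt0. Qed.

Lemma t0_gt0 : 0 < t0. Proof. exact: divr_gt0. Qed.

Lemma t0_le t : t0 <= t -> b + c2 * t <= c1 * t.
Proof. by rewrite ler_pdivrMr// mulrBr -lerBrDr (mulrC t) (mulrC t). Qed.

Lemma t0_lt t : t0 < t -> b + c2 * t < c1 * t.
Proof. by rewrite ltr_pdivrMr// mulrBr -ltrBrDr (mulrC t) (mulrC t). Qed.

Lemma t0_eq : b + c2 * t0 = c1 * t0.
Proof. by field; rewrite gt_eqF. Qed.

Lemma detSigma_gt0 s t : 0 < s -> s < t -> 0 < detSigma v s t.
Proof.
move=> s0 st; have t0 : 0 < t by apply: lt_trans st.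
rewrite lt_neqAle eq_sym det_neq0//=.
have := psd (v s) (- Gam v s t) (ltW t0) (ltW s0).
rewrite (_ : quad3 _ _ _ _ _ _ _ = v s * detSigma v s t); last first.
  by rewrite /quad3 (GamC v t s) /detSigma; ring.
by rewrite pmulr_rge0// vgt0.
Qed.

Lemma Gam_sub u t : 0 <= u -> u <= t -> Gam v (t - u) t = v t - Gam v u t.
Proof.
move=> u0 ut; have t0 : 0 <= t by apply: le_trans ut.
rewrite /Gam (_ : t - (t - u) = u); last by ring.
by rewrite !ger0_norm ?subr_ge0//; field.
Qed.

Lemma v_sub u t : 0 <= u -> u <= t -> v (t - u) = v t + v u - 2 * Gam v u t.
Proof.
move=> u0 ut; have t0 : 0 <= t by apply: le_trans ut.
by rewrite /Gam !ger0_norm ?subr_ge0//; field.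
Qed.

Lemma Gam_ge0 s t : 0 <= s -> s <= t -> 0 <= Gam v s t.
Proof.
move=> s0 st; have t0 : 0 <= t by apply: le_trans st.
rewrite /Gam !ger0_norm ?subr_ge0// divr_ge0// -addrA addr_ge0//.
  by case: vF => + _ _ _; apply.
rewrite subr_ge0; move: s0; rewrite le_eqVlt => /orP[/eqP<-|s0].
  by rewrite subr0.
by apply/ltW/(v_lt vF gmono); [rewrite subr_ge0|rewrite gtrBl].
Qed.

Lemma Gam_le_sqrtv s t : 0 < s -> s < t -> Gam v s t <= g s * g t.
Proof.
move=> s0 st; have t0 : 0 < t by apply: lt_trans st.
have gg : 0 <= g s * g t by rewrite mulr_ge0 ?sqrtr_ge0.
rewrite -ler_sqr ?nnegrE//; last by apply: Gam_ge0; exact: ltW.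
have /ltW := detSigma_gt0 s0 st; rewrite /detSigma subr_ge0 mulrC.
by rewrite [(g s * g t) ^+ 2]exprMn (sqrtv_sqr vF (ltW s0)) (sqrtv_sqr vF (ltW t0)).
Qed.

(* The conditional variance of [A(-s,0)] given [A(-t,0)]. *)
Definition vcond s t : R := detSigma v s t / v t.

Lemma vcond_gt0 s t : 0 < s -> s < t -> 0 < vcond s t.
Proof.
by move=> s0 st; rewrite divr_gt0 ?detSigma_gt0 ?vgt0// (lt_trans s0).
Qed.

(** Cost of the value [y] at time [t], plus the conditional cost of removing the excess [X] at time
    [s]. The positive part merges the two branches of [Ups] into one continuous formula. *)
Definition Psi (V D y X : R) : R := y ^+ 2 / (2 * V) + Num.max 0 X ^+ 2 / (2 * D).

Lemma LamE s t y x : 0 < s -> s < t ->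
  Lam v s t y (y - x) = y ^+ 2 / (2 * v t) +
    (Gam v s t / v t * y - x) ^+ 2 / (2 * vcond s t).
Proof.
move=> s0 st; have t0 : 0 < t by apply: lt_trans st.
have vt := vgt0 t0; have dt := detSigma_gt0 s0 st.
rewrite /Lam /halfQuadInv /vcond Gam_sub ?v_sub ?ltW//.
have -> : v t * (v t + v s - 2 * Gam v s t) - (v t - Gam v s t) ^+ 2 = detSigma v s t.
  by rewrite /detSigma; ring.
move: dt; rewrite /detSigma => dt.
by field; rewrite !gt_eqF.
Qed.

Lemma UpsE s t : 0 < s -> s < t -> Ups v b c1 c2 s t =
  Psi (v t) (vcond s t) (b + c2 * t) (kfun v b c2 s t - c1 * s).
Proof.
move=> s0 st; rewrite /Ups /Psi; case: ltP => h.
  by rewrite LamE// (max_idPr _)// subr_ge0 ltW.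
by rewrite (max_idPl _) ?expr0n ?mul0r ?addr0//= subr_le0.
Qed.

Lemma Psi_scale V D y X s : 0 < s -> 0 < D ->
  Psi V (s ^+ 2 * D) y (s * X) = Psi V D y X.
Proof.
move=> s0 D0; rewrite /Psi; congr (_ + _).
rewrite -{1}(mulr0 s) -maxr_pMr ?(ltW s0)//; field.
by rewrite !gt_eqF.
Qed.

Lemma Psi_le V D y X X' : 0 < D -> X <= X' -> Psi V D y X <= Psi V D y X'.
Proof.
move=> D0 XX; rewrite /Psi lerD2l ler_pM2r ?invr_gt0 ?mulr_gt0//.
have m0 Y : 0 <= Num.max 0 Y :> R by rewrite le_max lexx.
by rewrite ler_sqr ?nnegrE// ge_max m0/= le_max XX orbT.
Qed.

Lemma Psi_cvg (F : set_system (R * R)) {FF : Filter F} (V D y X : R * R -> R)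
   (V' D' y' X' : R) : 0 < V' -> 0 < D' ->
  V @ F --> V' -> D @ F --> D' -> y @ F --> y' -> X @ F --> X' ->
  (fun z => Psi (V z) (D z) (y z) (X z)) @ F --> Psi V' D' y' X'.
Proof.
move=> V0 D0 VF DF yF XF; apply: cvgD.
  apply: cvgM; first by apply: cvgM.
  apply: cvgV; first by rewrite mulf_neq0// gt_eqF.
  by apply: cvgM => //; exact: cvg_cst.
apply: cvgM.
  have h : (fun z => Num.max 0 (X z)) @ F --> Num.max 0 X'.
    apply: (cvg_comp X (fun x => Num.max 0 x)); first exact: XF.
    by apply: (@continuous_max _ _ (cst 0) id X'); [exact: cvg_cst|exact: cvg_id].
  by apply: cvgM.
apply: cvgV; first by rewrite mulf_neq0// gt_eqF.
by apply: cvgM => //; exact: cvg_cst.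
Qed.

(** In the branch [Lam], the weights are the inverse covariance matrix applied to the two levels,
    times the determinant. Then [L = N] and [q = detSigma * N], so [L^2 / (2 q)] is exactly [Ups].
    In the other branch the constraint at [s] gets weight 0. *)
Lemma Ups_halfspace s t x : 0 < s -> s < t -> t0 <= t -> x < Ups v b c1 c2 s t ->
  exists al be : R, let L := al * (b + c2 * t) + be * (b + c2 * t - c1 * s) in
  let q := quad3 v (al + be) (- be) 0 t s t in
  [/\ 0 <= al, 0 <= be, 0 < L, 0 < q & 2 * x * q < L ^+ 2].
Proof.
move=> s0 st tt0 xU; have t0' : 0 < t by apply: lt_trans st.
have vt := vgt0 t0'; have dt := detSigma_gt0 s0 st; have vs := vgt0 s0.
have y0 : 0 < b + c2 * t by rewrite addr_gt0// mulr_gt0.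
have [kc|kc] := ltP (c1 * s) (kfun v b c2 s t); last first.
  exists 1, 0 => /=; rewrite mul0r addr0 mul1r; split => //.
    by rewrite /quad3; move: vt; lra.
  move: xU; rewrite /Ups (ltNge (c1 * s)) kc/= ltr_pdivlMr ?mulr_gt0// => h.
  by rewrite /quad3; move: h; lra.
pose V := v t; pose S := v s; pose C := Gam v s t; pose y := b + c2 * t; pose X := c1 * s.
have be0 : 0 < C * y - V * X.
  by move: kc; rewrite /kfun mulrAC ltr_pdivlMr// subr_gt0 mulrC.
(* After multiplication by [t] the expression splits in two: one part is nonnegative by
   Cauchy-Schwarz and the decreasing chord slope, the other because [y <= c1 t] for [t >= t0]. *)
have al0 : 0 <= y * (S - C) + X * (V - C).
  have u0 : 0 < t - s by rewrite subr_gt0.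
  have ut : t - s < t by rewrite gtrBl.
  have VC : V - C = Gam v (t - s) t by rewrite Gam_sub ?ltW.
  have VC0 : 0 <= V - C by rewrite VC Gam_ge0 ?ltW.
  have SC : S - C = v (t - s) - (V - C) by rewrite v_sub ?ltW// /V /S /C; ring.
  have yX : y * s <= X * t by rewrite /X mulrAC ler_pM2r// t0_le.
  rewrite SC -(pmulr_lge0 _ t0').
  have -> : (y * (v (t - s) - (V - C)) + X * (V - C)) * t =
    y * (t * v (t - s) - (t - s) * (V - C)) + (X * t - y * s) * (V - C) by ring.
  apply: addr_ge0; last by rewrite mulr_ge0// subr_ge0.
  rewrite mulr_ge0 ?(ltW y0)// subr_ge0 -(sqrtv_sqr vF (ltW u0)) VC.
  apply: (@le_trans _ _ ((t - s) * (g (t - s) * g t))).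
    by rewrite ler_pM2l// Gam_le_sqrtv.
  rewrite expr2 mulrCA [leRHS]mulrCA ler_wpM2l ?sqrtr_ge0//.
  by apply: (sqrtv_star vF gconc); rewrite // ltW.
pose N := S * y ^+ 2 - 2 * C * X * y + V * X ^+ 2.
have NE : N / (2 * detSigma v s t) = Ups v b c1 c2 s t.
  rewrite /Ups kc (LamE _ _ s0 st) /vcond.
  move: dt; rewrite /detSigma /N /V /S /C /y /X => dt.
  by field; rewrite !gt_eqF.
have N0 : 0 < N.
  have : 0 < N / (2 * detSigma v s t).
    rewrite NE UpsE// /Psi ltr_wpDr ?divr_gt0 ?exprn_gt0 ?mulr_gt0//.
    by rewrite divr_ge0 ?sqr_ge0// mulr_ge0// ltW// vcond_gt0.
  by rewrite pmulr_lgt0// invr_gt0 mulr_gt0.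
pose al := y * (S - C) + X * (V - C).
exists al, (C * y - V * X); rewrite -/y -/X /=.
have LE : al * y + (C * y - V * X) * (y - X) = N by rewrite /al /N; ring.
have qE : quad3 v (al + (C * y - V * X)) (- (C * y - V * X)) 0 t s t = detSigma v s t * N.
  by rewrite /quad3 (GamC v t s) /al /N /detSigma -/V -/S -/C; ring.
rewrite LE qE; split => //; [exact: ltW|exact: mulr_gt0|].
move: xU; rewrite -NE ltr_pdivlMr ?mulr_gt0// => xN.
rewrite expr2 (_ : 2 * x * _ = x * (2 * detSigma v s t) * N); last by ring.
by rewrite ltr_pM2r.
Qed.

(** Conditional variance and excess at distance [s] from the end 0, divided by [s^2] and [s]. At
    distance [s] from the end [t] the variance is the same and the excess is [- Xn], up to the shift
    [b + c2 t - c1 t], which is nonpositive for [t >= t0] and zero at [t0]. *)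
Let Dn (z : R * R) : R := v `|z.1| / z.1 ^+ 2 - (Gam v z.1 z.2 / z.1) ^+ 2 / v `|z.2|.
Let Xn (z : R * R) : R := Gam v z.1 z.2 / z.1 / v `|z.2| * (b + c2 * z.2) - c1.

Let vcondE s t : 0 < s -> s < t -> vcond s t = s ^+ 2 * Dn (s, t).
Proof.
move=> s0 st; have t0 : 0 < t by apply: lt_trans st.
rewrite /vcond /Dn /detSigma /= !gtr0_norm//; field.
by rewrite !gt_eqF ?vgt0.
Qed.

Let Dn_gt0 s t : 0 < s -> s < t -> 0 < Dn (s, t).
Proof.
move=> s0 st; have := vcond_gt0 s0 st; rewrite vcondE//.
by rewrite pmulr_rgt0// exprn_gt0.
Qed.

Let near0E s t : 0 < s -> s < t ->
  Ups v b c1 c2 s t = Psi (v `|t|) (Dn (s, t)) (b + c2 * t) (Xn (s, t)).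
Proof.
move=> s0 st; have t0 : 0 < t by apply: lt_trans st.
rewrite UpsE// vcondE// (_ : kfun _ _ _ _ _ - _ = s * Xn (s, t)).
  by rewrite Psi_scale ?Dn_gt0// gtr0_norm.
by rewrite /kfun /Xn/= gtr0_norm//; field; rewrite !gt_eqF ?vgt0.
Qed.

Let near_end s t : 0 < s -> s < t -> kfun v b c2 (t - s) t - c1 * (t - s) =
  s * (- Xn (s, t)) + (b + c2 * t - c1 * t).
Proof.
move=> s0 st; have t0 : 0 < t by apply: lt_trans st.
rewrite /kfun /Xn/= gtr0_norm// Gam_sub ?ltW//.
by field; rewrite !gt_eqF ?vgt0.
Qed.

Let vcond_sub s t : 0 < s -> s < t -> vcond (t - s) t = s ^+ 2 * Dn (s, t).
Proof.
move=> s0 st; rewrite -vcondE// /vcond /detSigma Gam_sub ?v_sub ?ltW//.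
by congr (_ / _); ring.
Qed.

Let near_end_le s t : 0 < s -> s < t -> t0 <= t ->
  Ups v b c1 c2 (t - s) t <= Psi (v `|t|) (Dn (s, t)) (b + c2 * t) (- Xn (s, t)).
Proof.
move=> s0 st tt0; have t0' : 0 < t by apply: lt_trans st.
rewrite UpsE ?subr_gt0// ?gtrBl// vcond_sub// near_end//.
rewrite -[leRHS](@Psi_scale _ _ _ _ s) ?Dn_gt0// gtr0_norm//.
apply: Psi_le; first by rewrite mulr_gt0 ?Dn_gt0// exprn_gt0.
by rewrite gerDl subr_le0 t0_le.
Qed.

Let near_end_eq s : 0 < s -> s < t0 ->
  Ups v b c1 c2 (t0 - s) t0 = Psi (v `|t0|) (Dn (s, t0)) (b + c2 * t0) (- Xn (s, t0)).
Proof.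
move=> s0 st; have t0' := t0_gt0.
rewrite UpsE ?subr_gt0// ?gtrBl// vcond_sub// near_end// t0_eq subrr addr0.
by rewrite Psi_scale ?Dn_gt0// gtr0_norm.
Qed.

Let v_snd_cvg p : 0 < p -> (fun z : R * R => v `|z.2|) @ corner p --> v p.
Proof.
move=> p0; apply: (cvg_comp (fun z : R * R => z.2) (fun x : R => v `|x|)).
  exact: snd_corner_cvg.
by have := @continuous_v_norm _ _ vF p; rewrite /continuous_at (gtr0_norm p0).
Qed.

Let y_snd_cvg p : (fun z : R * R => b + c2 * z.2) @ corner p --> b + c2 * p.
Proof.
apply: cvgD; first exact: cvg_cst.
by apply: cvgM; [exact: cvg_cst|exact: snd_corner_cvg].
Qed.

Let ratio_cvg p : 0 < p -> (fun z : R * R => Gam v z.1 z.2 / z.1) @ corner p --> g p * g1 p.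
Proof. exact: Gam_ratio_cvg. Qed.

Let corner_Psi_cvg p (e : R) : 0 < p -> exists l : R,
  (fun z => Psi (v `|z.2|) (Dn z) (b + c2 * z.2) (e * Xn z)) @ corner p --> l.
Proof.
move=> p0; have vp := vgt0 p0.
have DD : Dn @ corner p --> g1 0 ^+ 2 - (g p * g1 p) ^+ 2 / v p.
  apply: cvgB; first exact: v_ratio_cvg.
  apply: cvgM; first by rewrite expr2; apply: cvgM; exact: ratio_cvg.
  by apply: cvgV; [rewrite gt_eqF|exact: v_snd_cvg].
have XX : Xn @ corner p --> g p * g1 p / v p * (b + c2 * p) - c1.
  apply: cvgB; last exact: cvg_cst.
  apply: cvgM; last exact: y_snd_cvg.
  apply: cvgM; first exact: ratio_cvg.
  by apply: cvgV; [rewrite gt_eqF|exact: v_snd_cvg].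
have D0 : 0 < g1 0 ^+ 2 - (g p * g1 p) ^+ 2 / v p.
  rewrite exprMn (sqrtv_sqr vF (ltW p0)) mulrAC divff ?gt_eqF// mul1r subr_gt0.
  have h0 := g1_ge0 vF dg cg1 gmono p0; have h := g1_lt vF dg cg1 gconc p0.
  by rewrite ltr_sqr ?nnegrE// (le_trans h0 (ltW h)).
exists (Psi (v p) (g1 0 ^+ 2 - (g p * g1 p) ^+ 2 / v p) (b + c2 * p)
  (e * (g p * g1 p / v p * (b + c2 * p) - c1))).
have eX : (fun z => e * Xn z) @ corner p --> e * (g p * g1 p / v p * (b + c2 * p) - c1).
  by apply: cvgM; [exact: cvg_cst|exact: XX].
exact: (Psi_cvg vp D0 (v_snd_cvg p0) DD (@y_snd_cvg p) eX).
Qed.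

Let interior_cvg p : 0 < p -> p < t0 ->
  (fun z : R * R => Psi (v `|z.2|) (v `|z.1| - Gam v z.1 z.2 ^+ 2 / v `|z.2|)
     (b + c2 * z.2) (Gam v z.1 z.2 / v `|z.2| * (b + c2 * z.2) - c1 * z.1))
  @ (p, t0) --> Ups v b c1 c2 p t0.
Proof.
move=> p0 pt; have t0' := t0_gt0; have vt := vgt0 t0'.
have c1z : (fun z : R * R => z.1) @ (p, t0) --> p by exact: cvg_fst.
have c2z : (fun z : R * R => z.2) @ (p, t0) --> t0 by exact: cvg_snd.
have vn (f : R * R -> R) (l : R) : f @ (p, t0) --> l ->
    (fun z => v `|f z|) @ (p, t0) --> v `|l|.
  move=> fl; apply: (cvg_comp f (fun x : R => v `|x|)); first exact: fl.
  exact: continuous_v_norm.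
have Gc : (fun z : R * R => Gam v z.1 z.2) @ (p, t0) --> Gam v p t0.
  apply: cvgM; last exact: cvg_cst.
  by apply: cvgB; [apply: cvgD|]; apply: vn => //; apply: cvgB.
have yc : (fun z : R * R => b + c2 * z.2) @ (p, t0) --> b + c2 * t0.
  by apply: cvgD; [exact: cvg_cst|apply: cvgM => //; exact: cvg_cst].
have Vc : (fun z : R * R => v `|z.2|) @ (p, t0) --> v t0.
  by rewrite -[X in v X](gtr0_norm t0'); exact: vn.
have Vi : (fun z : R * R => (v `|z.2|)^-1) @ (p, t0) --> (v t0)^-1.
  by apply: cvgV => //; rewrite gt_eqF.
rewrite UpsE//; apply: Psi_cvg => //.
- exact: vcond_gt0.
- rewrite (_ : vcond p t0 = v `|p| - Gam v p t0 ^+ 2 / v t0); last first.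
    by rewrite /vcond /detSigma gtr0_norm//; field; rewrite gt_eqF.
  apply: cvgB; first exact: vn.
  by apply: cvgM => //; apply: cvgM.
- apply: cvgB; last by apply: cvgM => //; exact: cvg_cst.
  by apply: cvgM => //; apply: cvgM.
Qed.

(* Upper semicontinuity of the supremum over [s] as [t] decreases to [t0]: near the ends
   [s = 0] and [s = t] the conditional variance degenerates like the square of the distance
   to the end, and so does the squared numerator. *)
Lemma Ups_at_t0 (J x : R) :
  (forall t, t0 < t -> (J%:E <= supUps v b c1 c2 t)%E) -> x < J ->
  exists s, [/\ 0 < s, s < t0 & x < Ups v b c1 c2 s t0].
Proof.
move=> HJ xJ; apply: contrapT => Hne.
have Hle s : 0 < s -> s < t0 -> Ups v b c1 c2 s t0 <= x.
  by move=> s0 st; rewrite leNgt; apply/negP => h; apply: Hne; exists s.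
have t0' := t0_gt0.
pose x' := (x + J) / 2.
have xx' : x < x' by rewrite /x'; lra.
have x'J : x' < J by rewrite /x'; lra.
(* The limit may be taken along [t = t0], where the bound [x] holds; its existence as a joint limit
   then carries the bound, relaxed to [x'], to nearby [t]. *)
have cornerx (f : R * R -> R) (l : R) : f @ corner t0 --> l ->
    (forall s, 0 < s -> s < t0 -> f (s, t0) <= x) ->
    exists2 e : R, 0 < e & forall s t, 0 < s -> s < e -> `|t - t0| < e -> f (s, t) <= x'.
  move=> fl fx.
  have lx : l <= x.
    rewrite leNgt; apply/negP => xl.
    have /cvgrPdist_lt/(_ (l - x)) := fl; rewrite subr_gt0 => /(_ xl)/cornerP[e e0 H].
    pose s := Num.min (e / 2) (t0 / 2).
    have s0 : 0 < s by rewrite lt_min !divr_gt0.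
    have se : s < e by rewrite gt_min; apply/orP; left; lra.
    have st : s < t0 by rewrite gt_min; apply/orP; right; lra.
    have := H s t0 s0 se; rewrite subrr normr0 => /(_ e0).
    rewrite ltr_distlC => /andP[+ _]; rewrite opprB addrC subrK.
    by rewrite ltNge fx.
  have /cvgrPdist_lt/(_ (x' - l)) := fl.
  rewrite subr_gt0 (le_lt_trans lx)// => /(_ isT)/cornerP[e e0 H].
  exists e => // s t s0 se te; have := H s t s0 se te.
  by rewrite ltr_distlC => /andP[_]; rewrite addrC subrK => /ltW.
pose Q (S : set R) := exists2 e : R, 0 < e & forall s t, S s -> t0 < t -> t < t0 + e ->
  0 < s -> s < t -> Ups v b c1 c2 s t <= x'.
(* The segment runs past [t0] so as to contain all [s < t] for [t <= t0 + 1]; around a point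
   [p > t0] the claim is void once [t] is close enough to [t0]. *)
have : Q `[0, t0 + 1]%classic.
  apply: segment_induction.
  - by move=> S S' SS' [e e0 H]; exists e => // s t /SS'; exact: H.
  - by exists 1.
  - move=> S S' [e e0 H] [e' e'0 H']; exists (Num.min e e'); first by rewrite lt_min e0.
    move=> s t [Ss|Ss] tt te; [apply: H|apply: H'] => //.
      by apply: (lt_le_trans te); rewrite lerD2l ge_min lexx.
    by apply: (lt_le_trans te); rewrite lerD2l ge_min lexx orbT.
  move=> p p0 pt1; have [pt|tp|pt] := ltgtP p t0.
  - have [pp|pe] : 0 < p \/ p = 0 by move: p0; rewrite le_eqVlt => /orP[/eqP<-|]; [right|left].
      have /cvgrPdist_lt/(_ (x' - Ups v b c1 c2 p t0)) := interior_cvg pp pt.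
      rewrite subr_gt0 (le_lt_trans (Hle _ pp pt))// => /(_ isT)/nbhs_ballP[e /= e0 H].
      exists e => //; exists e => // s t ps tt te s0 st.
      have t00 : 0 < t by apply: lt_trans st.
      have : ball (p, t0) e (s, t).
        by split => //; rewrite /ball/= ltr_distlC; apply/andP; split; lra.
      move=> /H/=; rewrite ltr_distlC => /andP[_]; rewrite [X in _ < X]addrC subrK => /ltW.
      congr (_ <= _); rewrite UpsE// !gtr0_norm// /vcond /detSigma; congr Psi.
      by field; rewrite gt_eqF ?vgt0.
    have [l] := corner_Psi_cvg 1 t0' => /cornerx[].
      move=> s s0 st; rewrite mul1r -near0E//; exact: Hle.
    move=> e e0 H; exists e => //; exists e => // s t ps tt te s0 st.
    rewrite near0E// -[Xn _]mul1r; apply: H => //.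
      by move: ps; rewrite pe /ball/= sub0r normrN gtr0_norm.
    by rewrite ltr_distl; apply/andP; split; lra.
  - exists ((p - t0) / 2); first by rewrite divr_gt0// subr_gt0.
    exists ((p - t0) / 2); first by rewrite divr_gt0// subr_gt0.
    move=> s t; rewrite /ball/= ltr_distlC => /andP[? ?] ? ? ? ?.
    by exfalso; lra.
  - have [l] := corner_Psi_cvg (-1) t0' => /cornerx[].
      move=> s s0 st; rewrite mulN1r -near_end_eq//; apply: Hle; lra.
    move=> e e0 H; exists (e / 2); first by rewrite divr_gt0.
    exists (e / 2); first by rewrite divr_gt0.
    move=> s t; rewrite pt /ball/= ltr_distlC => /andP[? ?] tt te s0 st.
    have -> : s = t - (t - s) by ring.
    apply: le_trans (near_end_le _ _ _) _; rewrite ?subr_gt0//; [lra|exact: ltW|].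
    rewrite -[- Xn _]mulN1r; apply: H; first by rewrite subr_gt0.
      lra.
    by rewrite ltr_distl; apply/andP; split; lra.
move=> [e e0 H]; pose t := t0 + Num.min (e / 2) 1.
have tt : t0 < t by rewrite ltrDl lt_min divr_gt0//=.
have te : t < t0 + e by rewrite ltrD2l gt_min; apply/orP; left; lra.
have t1 : t <= t0 + 1 by rewrite lerD2l ge_min lexx orbT.
have : (supUps v b c1 c2 t <= x'%:E)%E.
  apply: ge_ereal_sup => y [s /=]; rewrite in_itv/= => /andP[s0 st] <-.
  rewrite lee_fin; apply: H => //=; rewrite in_itv/= (ltW s0)/=.
  by rewrite (le_trans (ltW st)).
by move=> /(le_trans (HJ t tt)); rewrite lee_fin leNgt x'J.
Qed.

End Upsilon.

(** * The queue event and the upper bound *)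

Section QueueEvent.
Context {R : realType} {d : measure_display} {T : measurableType d}.
Variables (P : probability T R) (v : R -> R) (A : nat -> R -> T -> R).
Hypothesis iidA : iid_gaussian_copies P v A.
Implicit Types (n : nat) (c s t : R) (w : T).

Local Notation agg := (agg A).

Lemma supPart_ge n c w t : 0 < t ->
  ((agg n t w - n%:R * c * t)%:E <= supPart A n c w)%E.
Proof.
by move=> t0; apply: ereal_sup_ubound; exists t => //=; rewrite in_itv/= t0.
Qed.

Lemma supPart_le n c w (B : \bar R) :
  (forall t, 0 < t -> ((agg n t w - n%:R * c * t)%:E <= B)%E) ->
  (supPart A n c w <= B)%E.
Proof.
move=> H; apply: ge_ereal_sup => y [t /=]; rewrite in_itv/= andbT => t0 <-.
exact: H.
Qed.

(** Time 0 is excluded from the supremum; continuity of the path at 0 replaces evaluation there. *)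
Lemma supPart_ge0 n c w : (0 <= supPart A n c w)%E.
Proof.
have h : (fun t : R => agg n t w - n%:R * c * t) @ (0 : R) --> (0 : R).
  have h1 := @continuous_agg _ _ _ _ _ _ iidA n w 0.
  have : (fun t : R => agg n t w - n%:R * c * t) @ (0 : R) --> agg n 0 w - n%:R * c * 0.
    by apply: cvgB; [exact: h1|apply: cvgM; [exact: cvg_cst|exact: cvg_id]].
  by rewrite agg0 mulr0 subrr.
apply/lee_addgt0Pr => e e0.
have /cvgrPdist_lt/(_ e e0)/nbhs_ballP[r /= r0 H] := h.
have r2 : 0 < r / 2 by rewrite divr_gt0.
have := H (r / 2); rewrite /ball/= sub0r normrN gtr0_norm//.
rewrite ltr_pdivrMr// ltr_pMr// ltr1n => /(_ isT).
rewrite sub0r normrN ltr_norml => /andP[re _].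
apply: (@le_trans _ _ ((agg n (r / 2) w - n%:R * c * (r / 2))%:E + e%:E)%E).
  by rewrite -EFinD lee_fin -lerBlDr sub0r ltW.
by apply: leeD => //; exact: supPart_ge.
Qed.

Variables (b c1 c2 : R).
Hypotheses (b0 : 0 < b) (c20 : 0 < c2) (c21 : c2 < c1).

Lemma Q2_gt_overflow n w : (0 < n)%N -> ((n%:R * b)%:E < Q2 A c1 c2 n w)%E ->
  exists2 t, b / (c1 - c2) < t & overflow A b c1 c2 n t w.
Proof.
move=> n0; have n0' : 0 < n%:R :> R by rewrite ltr0n.
rewrite /Q2; have := supPart_ge0 n c1 w.
have : forall s, 0 < s -> ((agg n s w - n%:R * c1 * s)%:E <= supPart A n c1 w)%E.
  by move=> s s0; exact: supPart_ge.
(* If this supremum is [+oo], the difference is [-oo], even in the form [+oo - +oo]. *)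
case: (supPart A n c1 w) => [m| |] Hm m0 //; last by rewrite addeC.
rewrite lteBrDr// -EFinD => /ereal_sup_gt[y [t /=]].
rewrite in_itv/= andbT => t0 <-; rewrite lte_fin -/(agg n t w) => ht.
have {}Hm s : 0 < s -> agg n s w - n%:R * c1 * s <= m.
  by move=> /Hm; rewrite lee_fin.
rewrite lee_fin in m0.
exists t; last first.
  split; first by move: ht m0; lra.
  by move=> s /Hm; move: ht; lra.
(* The constraint at [s = t] itself forces [t > t0]. *)
rewrite ltr_pdivrMr ?subr_gt0// mulrC.
rewrite -(ltr_pM2l n0'); have := Hm t t0; move: ht; lra.
Qed.

End QueueEvent.

Section UpperBound.
Context {R : realType} {d : measure_display} {T : measurableType d}.
Variables (P : probability T R) (v g1 : R -> R) (A : nat -> R -> T -> R).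
Variables (b c1 c2 : R).
Local Notation g := (sqrtv v).
Local Notation t0 := (b / (c1 - c2)).
Hypotheses (vF : variance_fun v) (iidA : iid_gaussian_copies P v A).
Hypotheses (dg : forall t : R, 0 < t -> is_derive t 1 g (g1 t)).
Hypotheses (cg1 : {within `[0, +oo[, continuous g1}).
Hypotheses (gmono : forall x y : R, 0 <= x -> x < y -> g x < g y).
Hypotheses (gconc : forall x y l : R, 0 <= x -> 0 <= y -> x != y -> 0 < l -> l < 1 ->
          l * g x + (1 - l) * g y < g (l * x + (1 - l) * y)).
Hypotheses (det_neq0 : forall s t : R, 0 < s -> s < t -> detSigma v s t != 0).
Hypotheses (b0 : 0 < b) (c20 : 0 < c2) (c21 : c2 < c1).

Lemma Q2_exp_small (J x : R) :
  (forall t, t0 < t -> (J%:E <= supUps v b c1 c2 t)%E) -> x < J ->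
  exp_small P (fun n => [set w | ((n%:R * b)%:E < Q2 A c1 c2 n w)%E]) x.
Proof.
move=> HJ xJ.
have v0 : v 0 = 0 by case: vF.
have psd (a c x1 y : R) : 0 <= x1 -> 0 <= y -> 0 <= quad3 v a c 0 x1 y x1.
  by move=> x0 y0; exact: (quad3_ge0 v0 iidA).
have G0 := g1_0_gt0 vF dg cg1 gmono gconc.
have vG u : 0 <= u -> v u <= (g1 0 * u) ^+ 2 by exact: (v_le_sqr vF dg cg1 gmono gconc).
have vgt0 t : 0 < t -> 0 < v t by exact: (v_gt0 vF gmono).
have t0' : 0 < t0 := t0_gt0 b0 c21.
have [T1 T10 tailT] := agg_tail vF iidA G0 vG vgt0 x c20.
pose Q (S : set R) := exp_small P (fun n =>
  [set w | exists2 t, S t & t0 < t /\ overflow A b c1 c2 n t w]) x.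
have QT : Q `[t0, T1]%classic.
  apply: segment_induction.
  - by move=> S S' SS'; apply: exp_smallS => n _ w [t St H]; exists t => //; exact: SS'.
  - by apply: exp_smallS (exp_small0 P x) => n _ w [].
  - move=> S S' QS QS'; apply: exp_smallS (exp_smallU QS QS') => n _ w [t [St|St] H].
      by left; exists t.
    by right; exists t.
  move=> t tt0 _.
  have [s [s0 st xU]] : exists s, [/\ 0 < s, s < t & x < Ups v b c1 c2 s t].
    move: tt0; rewrite le_eqVlt => /orP[/eqP<-|tt0].
      exact: (Ups_at_t0 vF dg cg1 gmono gconc psd det_neq0 b0 c21 HJ xJ).
    have : (x%:E < supUps v b c1 c2 t)%E by apply: lt_le_trans (HJ t tt0); rewrite lte_fin.
    move=> /ereal_sup_gt[y [s /=]]; rewrite in_itv/= => /andP[s0 st] <-.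
    by rewrite lte_fin => xU; exists s.
  have [al [be [al0 be0 L0 q0 xqL]]] :=
    Ups_halfspace vF gmono gconc psd det_neq0 b0 c20 c21 s0 st tt0 xU.
  have [e e0 He] := overflow_local vF iidA G0 vG c20 (lt_trans s0 st) s0 al0 be0 L0 q0 xqL.
  exists e => //; apply: exp_smallS He => n _ w [t' tt' [_ ov]].
  by exists t'.
apply: exp_smallS (exp_smallU QT tailT) => n n0 w /= /(Q2_gt_overflow iidA c21 n0)[t tt ov].
have [tT|Tt] := leP t T1; [left|right]; exists t => //.
- by rewrite /= in_itv/= (ltW tt).
- exact: ltW.
case: ov => ov _; apply: le_trans ov; rewrite ler_wpM2l// lerDr ltW//.
Qed.

End UpperBound.

(** * Measurability of the queue event *)

Section Measurability.
Context {R : realType} {d : measure_display} {T : measurableType d}.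
Variables (P : probability T R) (v : R -> R) (A : nat -> R -> T -> R).
Hypothesis iidA : iid_gaussian_copies P v A.
Implicit Types (n k : nat) (c t : R) (w : T).

Local Notation agg := (agg A).

(** Enumerates the nonnegative rationals. The default 0 is harmless: the value at time 0 is 0, which
    never exceeds the supremum. *)
Let rat_seq k : R := `|ratr (odflt 0 (unpickle k : option rat))|.

Let val n c k w : \bar R := (agg n (rat_seq k) w - n%:R * c * rat_seq k)%:E.

Lemma supPart_countable n c w : supPart A n c w = esups (fun k => val n c k w) 0.
Proof.
rewrite /esups/= /sdrop; apply/eqP; rewrite eq_le; apply/andP; split.
  apply: supPart_le => t t0; apply/lee_addgt0Pr => e e0.
  have h : (fun t : R => agg n t w - n%:R * c * t) @ t --> agg n t w - n%:R * c * t.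
    apply: cvgB; first exact: (continuous_agg iidA).
    by apply: cvgM; [exact: cvg_cst|exact: cvg_id].
  have /cvgrPdist_lt/(_ e e0)/nbhs_ballP[r /= r0 H] := h.
  have tr : t < t + r by rewrite ltrDl.
  have [q] := rat_in_itvoo tr; rewrite in_itv/= => /andP[tq qr].
  have q0 : 0 < ratr q :> R by apply: lt_trans tq.
  have qE : rat_seq (pickle q) = ratr q by rewrite /rat_seq pickleK/= gtr0_norm.
  apply: (@le_trans _ _ (val n c (pickle q) w + e%:E)%E).
    have := H (ratr q); rewrite /ball/= ltr_distlC (_ : _ && _); last first.
      by apply/andP; split; lra.
    move=> /(_ isT); rewrite /val qE -EFinD lee_fin ltr_distlC => /andP[+ _].
    lra.
  by apply: leeD => //; apply: ereal_sup_ubound; exists (pickle q).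
apply: ge_ereal_sup => y [k _ <-]; rewrite /val.
have [->|k0] := eqVneq (rat_seq k) 0.
  by rewrite agg0 mulr0 subrr (supPart_ge0 iidA).
by apply: supPart_ge; rewrite lt_neqAle eq_sym k0 normr_ge0.
Qed.

Lemma measurable_supPart n c : measurable_fun setT (supPart A n c).
Proof.
rewrite (_ : supPart A n c = fun w => esups ((val n c)^~ w) 0); last first.
  by apply/funext => w; exact: supPart_countable.
apply: measurable_fun_esups => // k; apply/measurable_EFinP.
by apply: measurable_funB => //; exact: (measurable_agg iidA).
Qed.

Lemma measurable_Q2_gt n (b c1 c2 : R) :
  measurable [set w | ((n%:R * b)%:E < Q2 A c1 c2 n w)%E].
Proof.
rewrite -[X in measurable X]setTI; apply: emeasurable_fun_o_infty => //.
by apply: emeasurable_funB; exact: measurable_supPart.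
Qed.

End Measurability.

(** * The lower bound *)

Section LowerBound.
Context {R : realType} {d : measure_display} {T : measurableType d}.
Variables (P : probability T R) (v : R -> R) (A : nat -> R -> T -> R) (G : R).
Variables (b c1 c2 : R).
Hypotheses (vF : variance_fun v) (iidA : iid_gaussian_copies P v A).
Hypotheses (G0 : 0 < G) (vG : forall u, 0 <= u -> v u <= (G * u) ^+ 2).
Hypothesis vgt0 : forall t, 0 < t -> 0 < v t.
Hypotheses (b0 : 0 < b) (c20 : 0 < c2) (c21 : c2 < c1).
Implicit Types (n k j : nat) (s t x : R) (w : T).

Local Notation agg := (agg A).

Let v0 : v 0 = 0. Proof. by case: vF. Qed.

Lemma exp_small_bigcup_gap (N : nat) (E : nat -> nat -> set T) (x : R) :
  (forall j, (j < N)%N -> exists2 ga : R, 0 < ga & exp_small P (E j) (x + ga)) ->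
  exists2 ga : R, 0 < ga & exp_small P (fun n => \bigcup_(j < N) E j n) (x + ga).
Proof.
elim: N => [|N IH] H.
  by exists 1 => //; apply: exp_smallS (exp_small0 P _) => n _ w [].
have [ga ga0 EN] := H N (ltnSn N).
have /IH[ga' ga'0 EI] : forall j, (j < N)%N ->
    exists2 ga : R, 0 < ga & exp_small P (E j) (x + ga).
  by move=> j jN; apply: H; exact: ltnW.
exists (Num.min ga ga'); first by rewrite lt_min ga0.
apply: (@exp_smallS _ _ _ _ _ (fun n => (\bigcup_(j < N) E j n) `|` E N n)).
  move=> n _ w [j /=]; rewrite ltnS leq_eqVlt => /orP[/eqP-> Ew|jN Ew]; [by right|left].
  by exists j.
apply: exp_smallU.
  by apply: exp_small_le EI; rewrite lerD2l ge_min lexx orbT.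
by apply: exp_small_le EN; rewrite lerD2l ge_min lexx.
Qed.

Variables (ts ss th1 th2 : R).
Hypotheses (ts0 : 0 < ts) (ss0 : 0 < ss).
(** Per copy, [q] is the variance of the combination and [F s] its covariance with [A(-s,0)]; at
    [U = n q] the regression of [B_n(s)] on [U] is [n F s]. *)
Let q := quad3 v th1 th2 0 ts ss ts.
Let F s := th1 * Gam v s ts + th2 * Gam v s ss.
Let U n w := th1 * agg n ts w + th2 * agg n ss w + 0 * agg n ts w.
Hypothesis q0 : 0 < q.

(* A half-space with a slightly tilted normal contains the event and lies farther away, so a
   deviation of the path from its regression on [U] costs an extra exponential factor. *)
Lemma regression_deviation r mu : 0 <= r -> 0 < mu ->
  exists2 ga : R, 0 < ga & exp_small P (fun n =>
    [set w | n%:R * q <= U n w /\ agg n ts w - agg n r w <= n%:R * (F ts - F r - mu)])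
    (q / 2 + ga).
Proof.
move=> r0 mu0; pose D := F ts - F r; pose V := v `|ts - r|.
have V0 : 0 <= V by case: vF => + _ _ _; apply.
(* The first bound keeps the tilted variance [sg] at least [q / 2]; the second makes the quadratic
   term [lam^2 V] at most [lam mu], half of the linear gain. *)
pose lam := Num.min (q / (4 * (`|D| + 1))) (mu / (V + 1)).
have D1 : 0 < `|D| + 1 by rewrite ltr_wpDl.
have V1 : 0 < V + 1 by rewrite ltr_wpDl.
have lam0 : 0 < lam by rewrite lt_min !divr_gt0// mulr_gt0.
have lamD : lam * `|D| <= q / 4.
  apply: (@le_trans _ _ (lam * (`|D| + 1))); first by rewrite ler_pM2l// lerDl.
  have : lam <= q / (4 * (`|D| + 1)) by rewrite ge_min lexx.
  by rewrite ler_pdivlMr ?mulr_gt0//; lra.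
have lamV : lam * V <= mu.
  apply: (@le_trans _ _ (lam * (V + 1))); first by rewrite ler_pM2l// lerDl.
  have : lam <= mu / (V + 1) by rewrite ge_min lexx orbT.
  by rewrite ler_pdivlMr.
have [lD1 lD2] : - (q / 4) <= lam * D /\ lam * D <= q / 4.
  have : `|lam * D| <= q / 4 by rewrite normrM gtr0_norm.
  by rewrite ler_norml => /andP[].
pose sg := q - 2 * (lam * D) + lam * (lam * V).
have lV0 : 0 <= lam * (lam * V) by rewrite !mulr_ge0// ltW.
have sg0 : 0 < sg by rewrite /sg; move: q0 lD2 lV0; lra.
have sgE : quad3 v (th1 - lam) th2 lam ts ss r = sg.
  rewrite /sg /D /V /F /q /quad3 (GamC v r ts) (GamC v r ss).
  rewrite (_ : v `|ts - r| = v ts + v r - 2 * Gam v ts r); last first.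
    by rewrite /Gam (ger0_norm r0) (ger0_norm (ltW ts0)) (distrC r ts); field.
  by rewrite (Gam_diag _ v0) (ger0_norm (ltW ts0)); ring.
pose u := q + lam * mu - lam * D.
have lmu : 0 < lam * mu by rewrite mulr_gt0.
have u0 : 0 <= u by rewrite /u; move: q0 lD2 lmu; lra.
exists (lam * mu * q / (2 * sg)).
  by rewrite divr_gt0 ?mulr_gt0.
exists 1 => // n n0; have n0' : 0 < n%:R :> R by rewrite ltr0n.
exists [set w | (n%:R * u <= (th1 - lam) * agg n ts w + th2 * agg n ss w + lam * agg n r w)%R].
split.
- exact: (measurable_agg3_ge iidA).
- move=> w [] /=; rewrite -/D /U => h1 h2.
  by have := ler_wpM2l (ltW lam0) h2; rewrite /u; move: h1; lra.
have := @agg3_tail_le _ _ _ P v A v0 iidA n (th1 - lam) th2 lam ts ss r sg u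
  (ltW ts0) (ltW ss0) r0 n0 _ sg0 u0.
rewrite sgE => /(_ (lexx _))/le_trans; apply.
rewrite mul1r lee_fin ler_expR lerN2 ler_pM2l//.
have -> : q / 2 + lam * mu * q / (2 * sg) = (q * sg + lam * mu * q) / (2 * sg).
  by field; rewrite gt_eqF.
rewrite ler_pM2r ?invr_gt0 ?mulr_gt0//.
have -> : u ^+ 2 = q * sg + 2 * (lam * mu * q) - q * lam * (lam * V)
    + (lam * D - lam * mu) ^+ 2 by rewrite /u /sg; ring.
have := sqr_ge0 (lam * D - lam * mu).
have : q * lam * (lam * V) <= q * lam * mu by rewrite ler_pM2l// mulr_gt0.
have -> : q * lam * mu = lam * mu * q by ring.
lra.
Qed.

Hypothesis ts_t0 : b / (c1 - c2) < ts.

(** The control past [T1] makes the first supremum finite, so the difference is meaningful; [ka]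
    keeps the inequality strict through the second supremum. For [s > ts] no constraint is assumed:
    there [(c1 - c2) s] already exceeds [b + ka]. *)
Lemma overflow_Q2_gt n w (T1 ka : R) : (0 < n)%N -> 0 < ka ->
  ka <= (c1 - c2) * ts - b ->
  (forall s, 0 < s -> s <= ts -> n%:R * (b + c2 * ts - c1 * s + ka) <= agg n ts w - agg n s w) ->
  (forall t, T1 <= t -> agg n t w < n%:R * (c2 * t)) ->
  ((n%:R * b)%:E < Q2 A c1 c2 n w)%E.
Proof.
move=> n0 ka0 kat H HT; have n0' : 0 < n%:R :> R by rewrite ltr0n.
have [B HB] : exists B : R, forall t, 0 < t -> agg n t w - n%:R * c2 * t <= B.
  have T1' : 0 <= Num.max T1 0 by rewrite le_max lexx orbT.
  have [|c _ Hc] := @EVT_max R (fun t => agg n t w) 0 (Num.max T1 0) T1'.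
    by apply: continuous_subspaceT; exact: (continuous_agg iidA).
  exists (Num.max 0 (agg n c w)) => t t0; rewrite le_max.
  have ct : 0 <= n%:R * c2 * t by rewrite !mulr_ge0// ltW.
  have [tT|Tt] := leP T1 t.
    by apply/orP; left; have := HT t tT; rewrite mulrA; lra.
  apply/orP; right; have := Hc t; rewrite in_itv/= (ltW t0) le_max (ltW Tt)/= => /(_ isT).
  lra.
have : (supPart A n c2 w <= B%:E)%E.
  by apply: supPart_le => t t0; rewrite lee_fin; exact: HB.
have M2t t : 0 < t -> ((agg n t w - n%:R * c2 * t)%:E <= supPart A n c2 w)%E.
  exact: supPart_ge.
rewrite /Q2; move: M2t; case: (supPart A n c2 w) => [m| |]// M2t _; last first.
  by have := M2t ts ts0.
have {}M2t t : 0 < t -> agg n t w - n%:R * c2 * t <= m by move=> /M2t; rewrite lee_fin.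
have : (supPart A n c1 w <= (m - n%:R * b - n%:R * ka)%:E)%E.
  apply: supPart_le => s s0; rewrite lee_fin.
  have [sts|sts] := leP s ts.
    by have := H s s0 sts; have := M2t ts ts0; lra.
  have := M2t s s0.
  have : n%:R * ((c1 - c2) * ts) <= n%:R * ((c1 - c2) * s).
    by rewrite !ler_pM2l ?subr_gt0// ltW.
  have : n%:R * ka <= n%:R * ((c1 - c2) * ts - b) by rewrite ler_pM2l.
  lra.
have := supPart_ge0 iidA n c1 w.
have nka : 0 < n%:R * ka by rewrite mulr_gt0.
case: (supPart A n c1 w) => [m1| |]// _; rewrite lee_fin => hm.
by rewrite -EFinB lte_fin; lra.
Qed.

Let continuous_F : continuous F.
Proof.
move=> s; apply: cvgD; apply: cvgM; first [exact: cvg_cst|exact: continuous_Gam].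
Qed.

Hypothesis F_gap : forall s, 0 <= s -> s <= ts -> b + c2 * ts - c1 * s < F ts - F s.

Lemma not_Q2_exp_small : exists2 ga : R, 0 < ga &
  exp_small P (fun n => [set w | n%:R * q <= U n w /\
    ~ ((n%:R * b)%:E < Q2 A c1 c2 n w)%E]) (q / 2 + ga).
Proof.
have [|c] := @EVT_min R (fun s => F ts - F s - (b + c2 * ts - c1 * s)) 0 ts (ltW ts0).
  apply: continuous_subspaceT => s; apply: cvgB.
    by apply: cvgB; [exact: cvg_cst|exact: continuous_F].
  apply: cvgB; first exact: cvg_cst.
  by apply: cvgM; [exact: cvg_cst|exact: cvg_id].
rewrite in_itv/= => /andP[c0 cts].
(* A quarter of the minimal gap: one [mu] goes to the deviation at grid times, one to the
   oscillation between them, and [2 mu] remains as margin. *)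
pose mu := (F ts - F c - (b + c2 * ts - c1 * c)) / 4.
have mu0 : 0 < mu by rewrite divr_gt0// subr_gt0 F_gap.
move=> Hc.
have Fmu s : 0 <= s -> s <= ts -> b + c2 * ts - c1 * s + 4 * mu <= F ts - F s.
  move=> s0 sts; have := Hc s; rewrite in_itv/= s0 sts => /(_ isT).
  by rewrite /mu; lra.
have [K [K3 qK]] : exists K : R, 3 <= K /\ q / 2 + 1 <= K.
  by exists (Num.max (q / 2 + 1) 3); rewrite !le_max !lexx orbT.
have K0 : 0 < K by apply: lt_le_trans K3.
have [N [N0 HN]] : exists N, (0 < N)%N /\ 32 * K * (G * (ts / N%:R)) ^+ 2 <= mu ^+ 2.
  pose X := 32 * K * G * ts / mu.
  have X0 : 0 <= X by apply: divr_ge0; rewrite ?(ltW mu0)// !mulr_ge0// ltW.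
  have /andP[_ XN] := truncn_itv X0.
  exists (Num.truncn X).+1; split => //.
  move: XN; set N := (Num.truncn X).+1 => XN.
  have N0 : 0 < N%:R :> R by rewrite ltr0n.
  have h : 32 * K * (G * (ts / N%:R)) <= mu.
    move: XN; rewrite /X ltr_pdivrMr// => XN.
    by rewrite !mulrA ler_pdivrMr// mulrC (mulrC mu) ltW// mulrC.
  have e0 : 0 < G * (ts / N%:R) by rewrite mulr_gt0// divr_gt0.
  apply: (@le_trans _ _ ((32 * K * (G * (ts / N%:R))) ^+ 2)).
    rewrite [leRHS]exprMn ler_wpM2r ?sqr_ge0// expr2 ler_peMl//; lra.
  rewrite ler_sqr ?nnegrE ?(ltW mu0)// mulr_ge0 ?(ltW e0)//; lra.
pose dl := ts / N%:R; pose r j := j%:R * dl.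
have N0' : 0 < N%:R :> R by rewrite ltr0n.
have dl0 : 0 < dl by rewrite divr_gt0.
have r0 j : 0 <= r j by rewrite mulr_ge0// ltW.
have [ga ga0 devS] := @exp_small_bigcup_gap N _ (q / 2)
  (fun j _ => regression_deviation (r0 j) mu0).
have oscS : exp_small P (fun n => \bigcup_(j < N) [set w | exists t,
    [/\ r j <= t, t <= r j + dl & n%:R * mu < `|agg n t w - agg n (r j) w|]]) K.
  apply: (exp_small_bigcup (E := fun j n => [set w | exists t,
    [/\ r j <= t, t <= r j + dl & n%:R * mu < `|agg n t w - agg n (r j) w|]])) => j _.
  exists 4 => // n n0.
  have [M [mM PM HM]] := agg_osc v0 iidA G0 vG n0 (r0 j) dl0 (ltW mu0) K3 HN.
  exists M; split => // w [t [rt tr ht]]; apply: contrapT => /HM/(_ t rt tr).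
  by rewrite leNgt ht.
have [T1 T10 tailS] := agg_tail vF iidA G0 vG vgt0 K c20.
exists (Num.min ga 1); first by rewrite lt_min ga0 ltr01.
have gK : q / 2 + Num.min ga 1 <= K.
  by apply: le_trans qK; rewrite lerD2l ge_min lexx orbT.
have gg : q / 2 + Num.min ga 1 <= q / 2 + ga by rewrite lerD2l ge_min lexx.
apply: exp_smallS (exp_smallU (exp_small_le gg devS)
  (exp_smallU (exp_small_le gK oscS) (exp_small_le gK tailS))).
move=> n n0 w [hU nQ]; apply: contrapT => nbad; apply: nQ.
have n0' : 0 < n%:R :> R by rewrite ltr0n.
have tsb : 0 < (c1 - c2) * ts - b.
  by rewrite subr_gt0 mulrC -ltr_pdivrMr ?subr_gt0.
apply: (@overflow_Q2_gt n w T1 (Num.min (2 * mu) ((c1 - c2) * ts - b))) => //.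
- by rewrite lt_min tsb mulr_gt0.
- by rewrite ge_min lexx orbT.
- move=> s s0 sts.
  have [j [jN js sj]] : exists j, [/\ (j < N)%N, r j <= s & s <= r j + dl].
    have [sts'|sts'] := ltP s ts.
      have sd0 : 0 <= s / dl by rewrite divr_ge0 ?ltW.
      have /andP[h1 h2] := truncn_itv sd0; exists (Num.truncn (s / dl)); split.
      - by rewrite truncn_lt_nat// ltr_pdivrMr// /dl mulrC divfK// gt_eqF.
      - by rewrite /r -ler_pdivlMr.
      - by rewrite /r -[X in _ + X]mul1r -mulrDl natr1 -ler_pdivrMr// ltW.
    exists N.-1; rewrite prednK// leqnn; split => //.
      apply: le_trans sts'; rewrite /r /dl mulrA ler_pdivrMr// mulrC ler_pM2l//.
      by rewrite ler_nat leq_pred.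
    apply: (le_trans sts); rewrite /r -[X in _ + X]mul1r -mulrDl natr1 prednK//.
    by rewrite /dl mulrC divfK// gt_eqF.
  have hosc : `|agg n s w - agg n (r j) w| <= n%:R * mu.
    rewrite leNgt; apply/negP => h; apply: nbad; right; left; exists j => //.
    by exists s.
  have hdev : n%:R * (F ts - F (r j) - mu) < agg n ts w - agg n (r j) w.
    rewrite ltNge; apply/negP => h; apply: nbad; left; exists j => //.
  (* The grid point lies to the left of [s], where the constraint is stronger. *)
  have hF : b + c2 * ts - c1 * s + 4 * mu <= F ts - F (r j).
    apply: le_trans (Fmu (r j) (r0 j) _); last exact: le_trans js sts.
    by rewrite lerD2r lerD2l lerN2 ler_pM2l// (lt_trans c20).
  move: hosc; rewrite ler_norml => /andP[_ hosc].
  have : n%:R * (b + c2 * ts - c1 * s + Num.min (2 * mu) ((c1 - c2) * ts - b)) <=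
      n%:R * (F ts - F (r j) - 2 * mu).
    rewrite ler_pM2l//.
    have : Num.min (2 * mu) ((c1 - c2) * ts - b) <= 2 * mu by rewrite ge_min lexx.
    lra.
  lra.
- move=> t Tt; rewrite ltNge; apply/negP => h; apply: nbad; right; right.
  by exists t.
Qed.

Lemma Q2_prob_ge (y : R) : q / 2 < y ->
  \forall n \near \oo,
    ((expR (- (n%:R * y)))%:E <= P [set w | ((n%:R * b)%:E < Q2 A c1 c2 n w)%E])%E.
Proof.
move=> qy; have [ga ga0 [C C0 HC]] := not_Q2_exp_small.
(* For large [n], the half-space has probability at least twice [expR (- n (q / 2 + de))]; as
   [de < ga], the exceptional set takes at most one of these two shares. *)
pose de := Num.min (ga / 2) (y - q / 2).
have de0 : 0 < de by rewrite lt_min divr_gt0//= subr_gt0.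
have dega : de <= ga / 2 by rewrite ge_min lexx.
have dey : q / 2 + de <= y by rewrite -lerBrDl ge_min lexx orbT.
pose c0 : R := (Num.sqrt (pi *+ 2))^-1.
have c00 : 0 < c0 by rewrite invr_gt0 sqrtr_gt0 mulrn_wgt0// pi_gt0.
(* [X1] absorbs [sqrt (n q)] through AM-GM: [sqrt (n q) <= n de / 2 + q / (2 de)]. *)
pose X1 := (ln 2 - ln c0 + 2^-1 + q / (2 * de)) / (de / 2).
pose X2 := C / (ga / 2).
near=> n.
have n0 : (0 < n)%N by near: n; exact: nbhs_infty_gt.
have n0' : 0 < n%:R :> R by rewrite ltr0n.
have nX1 : X1 <= n%:R by near: n; exact: nbhs_infty_ger.
have nX2 : X2 <= n%:R by near: n; exact: nbhs_infty_ger.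
have [M [mM sM PM]] := HC n n0.
have mQ := measurable_Q2_gt iidA n b c1 c2.
set E := [set w | _] in mQ *.
have tail := @agg3_tail_ge _ _ _ P v A v0 iidA n th1 th2 0 ts ss ts (ltW ts0) (ltW ss0) (ltW ts0) n0 q0.
have sub : (P [set w | (n%:R * q <= U n w)%R] <= P E + P M)%E.
  apply: le_trans (measureU2 P mQ mM); apply: le_measure; rewrite ?inE.
  - exact: (measurable_agg3_ge iidA).
  - exact: measurableU.
  move=> w Uw; have [Ew|nE] := pselect (E w); [by left|right].
  by apply: sM; split.
have PEf : P E \is a fin_num by exact: fin_num_measure.
have amgm : Num.sqrt (n%:R * q) <= n%:R * de / 2 + q / (2 * de).
  rewrite -(@ler_pM2r _ (2 * de)) ?mulr_gt0//.
  have := sqr_ge0 (Num.sqrt n%:R * de - Num.sqrt q).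
  rewrite sqrtrM ?ler0n// sqrrB exprMn !sqr_sqrtr ?(ltW q0)//.
  have -> : (n%:R * de / 2 + q / (2 * de)) * (2 * de) = n%:R * de ^+ 2 + q.
    by field; rewrite gt_eqF.
  lra.
have h1 : 2 * expR (- (n%:R * (q / 2 + de))) <=
    c0 * expR (- (n%:R * (q / 2) + Num.sqrt (n%:R * q) + 2^-1)).
  rewrite -[X in X * _ <= _](@lnK _ 2) ?posrE// -[c0]lnK ?posrE// -!expRD ler_expR.
  move: nX1; rewrite /X1 ler_pdivrMr ?divr_gt0//; move: amgm; lra.
have h2 : C * expR (- (n%:R * (q / 2 + ga))) <= expR (- (n%:R * (q / 2 + de))).
  have -> : - (n%:R * (q / 2 + de)) = - (n%:R * (q / 2 + ga)) + n%:R * (ga - de) by ring.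
  rewrite expRD mulrC ler_pM2l ?expR_gt0//.
  apply: (@le_trans _ _ (n%:R * (ga / 2))).
    by move: nX2; rewrite /X2 ler_pdivrMr ?divr_gt0.
  apply: le_trans (expR_ge1Dx _).
  have : n%:R * (ga / 2) <= n%:R * (ga - de) by rewrite ler_pM2l//; lra.
  lra.
have h3 : expR (- (n%:R * y)) <= expR (- (n%:R * (q / 2 + de))).
  by rewrite ler_expR lerN2 ler_pM2l.
have := le_trans tail (le_trans sub (leeD (le_refl _) PM)).
rewrite -(fineK PEf) -EFinD !lee_fin -/c0 => h4.
lra.
Unshelve. all: by end_near. Qed.

End LowerBound.

(** * From exponential bounds to the logarithmic limit *)

Section RateConvergence.
Variable R : realType.

Lemma log_rate_cvg (p : nat -> R) (J : R) :
  (forall x, x < J -> exists2 C : R, 0 <= C & forall n, (0 < n)%N ->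
     p n <= C * expR (- (n%:R * x))) ->
  (forall y, J < y -> \forall n \near \oo, expR (- (n%:R * y)) <= p n) ->
  (fun n => n%:R^-1 * ln (p n)) @ \oo --> - J.
Proof.
move=> ub lb; apply/cvgrPdist_le => e e0.
have [|C C0 HC] := ub (J - e / 2); first by rewrite ltrBlDr ltrDl divr_gt0.
have Je : J < J + e by rewrite ltrDl.
near=> n.
have n0 : (0 < n)%N by near: n; exact: nbhs_infty_gt.
have n0' : 0 < n%:R :> R by rewrite ltr0n.
have nC : ln (C + 1) / (e / 2) <= n%:R by near: n; exact: nbhs_infty_ger.
have pl : expR (- (n%:R * (J + e))) <= p n by near: n; exact: lb.
have p0 : 0 < p n by apply: lt_le_trans pl; exact: expR_gt0.
have C1 : 0 < C + 1 by rewrite ltr_wpDl.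
have pu : p n <= (C + 1) * expR (- (n%:R * (J - e / 2))).
  by apply: (le_trans (HC n n0)); rewrite ler_wpM2r ?expR_ge0// lerDl.
have l1 : - (n%:R * (J + e)) <= ln (p n).
  by rewrite -[leLHS]expRK ler_ln ?posrE ?expR_gt0.
have l2 : ln (p n) <= ln (C + 1) - n%:R * (J - e / 2).
  rewrite -[X in _ + X]expRK -lnM ?posrE ?expR_gt0// ler_ln ?posrE//.
  by rewrite mulr_gt0 ?expR_gt0.
rewrite ler_distlC; apply/andP; split.
  rewrite -opprD ler_pdivlMl//; lra.
rewrite ler_pdivrMl//; move: nC; rewrite ler_pdivrMr ?divr_gt0//; lra.
Unshelve. all: by end_near. Qed.

End RateConvergence.

(** * Reproducing kernel norm of a combination of two kernels *)

Section RKHS.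
Context {R : realType} {d : measure_display} {T : measurableType d}.
Variables (P : probability T R) (v : R -> R) (A : nat -> R -> T -> R).
Hypotheses (v0 : v 0 = 0) (iidA : iid_gaussian_copies P v A).

Let form n (tm a : 'I_n -> R) : R :=
  \sum_(k < n) \sum_(l < n) a k * a l * Gam v (tm k) (tm l).

Let ext (x : R) n (f : 'I_n -> R) : 'I_n.+1 -> R := fun i => oapp f x (unlift ord0 i).

Let form_ext (x a0 : R) n (tm a : 'I_n -> R) : form (ext x tm) (ext a0 a) =
  a0 ^+ 2 * Gam v x x + 2 * a0 * (\sum_(k < n) a k * Gam v (tm k) x) + form tm a.
Proof.
rewrite /form !big_ord_recl /ext unlift_none/=.
under eq_bigr do rewrite liftK/=.
under [X in _ + X = _]eq_bigr => k _.
  rewrite big_ord_recl unlift_none liftK/=.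
  under eq_bigr do rewrite liftK/=.
  over.
rewrite big_split/= addrA; congr (_ + _).
rewrite -addrA expr2; congr (_ + _).
rewrite -mulrA mulr_natl mulr2n mulr_sumr.
congr (_ + _); apply: eq_bigr => k _; rewrite ?(GamC v x); ring.
Qed.

(** The upper bound is Cauchy-Schwarz: positivity of the form is applied to the test family enlarged
    by [mu c] at [p] and [mu c'] at [p'], with the minimizing [mu = - B / Q]. Equality is attained
    by the weights [c], [c'] divided by [sqrt Q]. *)
Lemma rkhs_norm2_two_points (f : R -> R) (p p' c c' : R) :
  (forall r, f r = c * Gam v r p + c' * Gam v r p') ->
  let Q := c ^+ 2 * Gam v p p + 2 * (c * c' * Gam v p p') + c' ^+ 2 * Gam v p' p' in
  0 < Q -> rkhs_norm2 v f = Q%:E.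
Proof.
move=> fE Q Q0; apply/eqP; rewrite eq_le; apply/andP; split.
  apply: ge_ereal_sup => _ [n [tm [a [S1 ->]]]]; rewrite lee_fin.
  pose B := \sum_(k < n) a k * f (tm k); pose mu := - (B / Q).
  have := Gam_psd iidA (ext p (ext p' tm)) (ext (mu * c) (ext (mu * c') a)).
  rewrite -/(form _ _) !form_ext big_ord_recl /ext unlift_none/=.
  under eq_bigr do rewrite liftK/=.
  rewrite -/B.
  have BE : B = c * (\sum_(k < n) a k * Gam v (tm k) p) + c' * (\sum_(k < n) a k * Gam v (tm k) p').
    rewrite !mulr_sumr -big_split/=; apply: eq_bigr => k _; rewrite fE; ring.
  set X := \sum_(k < n) _ in BE *; set Y := \sum_(k < n) _ in BE *.
  rewrite (GamC v p' p) -/(form tm a) in S1 *.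
  rewrite [X in 0 <= X -> _](_ : _ = mu ^+ 2 * Q + 2 * mu * B + form tm a); last first.
    by rewrite BE /Q; ring.
  have -> : mu ^+ 2 * Q + 2 * mu * B = - (B ^+ 2 / Q).
    by rewrite /mu; field; rewrite gt_eqF.
  move=> h; have : B ^+ 2 / Q <= 1 by move: h S1; rewrite -/(form tm a); lra.
  by rewrite ler_pdivrMr// mul1r.
apply: ereal_sup_ubound.
pose tm := ext p (ext p' (fun _ : 'I_0 => 0)).
pose a := ext (c / Num.sqrt Q) (ext (c' / Num.sqrt Q) (fun _ : 'I_0 => 0)).
have sQ0 : Num.sqrt Q != 0 by rewrite gt_eqF// sqrtr_gt0.
have sQ : Num.sqrt Q ^+ 2 = Q by rewrite sqr_sqrtr// ltW.
exists 2%N, tm, a; split.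
  rewrite -/(form tm a) !form_ext /form !big_ord_recl !big_ord0 /ext unlift_none/= !addr0.
  rewrite !mulr0 !addr0 (GamC v p' p).
  rewrite [leLHS](_ : _ = Q / Num.sqrt Q ^+ 2); last by rewrite /Q; field.
  by rewrite sQ divff// gt_eqF.
congr EFin; rewrite !big_ord_recl !big_ord0 /tm /a /ext unlift_none liftK/= unlift_none/= addr0.
rewrite !fE [X in X ^+ 2](_ : _ = Q / Num.sqrt Q); last first.
  by rewrite /Q (GamC v p' p); field.
by rewrite exprMn exprVn sQ; field; rewrite gt_eqF.
Qed.

Lemma Gam_CS (x y : R) : 0 < v `|y| -> Gam v x y ^+ 2 <= v `|x| * v `|y|.
Proof.
move=> vy.
have := Gam_psd iidA (ext x (ext y (fun _ : 'I_0 => 0)))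
  (ext (v `|y|) (ext (- Gam v x y) (fun _ : 'I_0 => 0))).
rewrite -/(form _ _) !form_ext /form !big_ord_recl !big_ord0 /ext unlift_none/= !addr0.
rewrite !(Gam_diag _ v0) (GamC v y x).
rewrite [X in 0 <= X](_ : _ = v `|y| * (v `|x| * v `|y| - Gam v x y ^+ 2)); last by ring.
by rewrite pmulr_rge0// subr_ge0.
Qed.

End RKHS.

(** * Sublinear paths and a perturbation in [Omega] *)

Section Omega.
Variable R : realType.
Implicit Types (f g : R -> R).

Definition sublinear f := forall e : R, 0 < e ->
  exists T0 : R, forall r : R, T0 <= `|r| -> `|f r| <= e * (1 + `|r|).

Lemma sublinearD f g : sublinear f -> sublinear g -> sublinear (fun r => f r + g r).
Proof.
move=> sf sg e e0; have e2 : 0 < e / 2 by rewrite divr_gt0.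
have [T0 H] := sf _ e2; have [T1 H'] := sg _ e2.
exists (Num.max T0 T1) => r; rewrite ge_max => /andP[/H h /H' h'].
by apply: le_trans (ler_normD _ _) _; lra.
Qed.

Lemma sublinearZ (c : R) f : sublinear f -> sublinear (fun r => c * f r).
Proof.
move=> sf e e0; have c1 : 0 < `|c| + 1 by rewrite ltr_wpDl.
have [T0 H] := sf (e / (`|c| + 1)) (divr_gt0 e0 c1).
exists T0 => r /H h; rewrite normrM.
apply: (@le_trans _ _ ((`|c| + 1) * `|f r|)); first by rewrite ler_wpM2r// lerDl.
by rewrite -ler_pdivlMl// mulrA (mulrC _ e).
Qed.

Lemma in_Omega_sublinear f : continuous f -> f 0 = 0 -> sublinear f -> in_Omega f.
Proof.
move=> cf f0 sf; split => //; apply/cvgrPdist_le => e e0; have [T0 H] := sf e e0.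
- near=> t; rewrite sub0r normrN normrM normfV (@ger0_norm _ (1 + `|t|)) ?addr_ge0//.
  rewrite ler_pdivrMr ?ltr_wpDr//; apply: H; apply: le_trans (ler_norm _).
  by near: t; apply: nbhs_pinfty_ge; rewrite num_real.
- near=> t; rewrite sub0r normrN normrM normfV (@ger0_norm _ (1 + `|t|)) ?addr_ge0//.
  rewrite ler_pdivrMr ?ltr_wpDr//; apply: H; rewrite -normrN; apply: le_trans (ler_norm _).
  by rewrite lerNr; near: t; apply: nbhs_ninfty_le; rewrite num_real.
Unshelve. all: by end_near. Qed.

(** Clamps [r] to [[-t, 0]]. Adding [e * ramp t] to a path raises [f (-s) - f (-t)] by
    [e (t - s) > 0], so weak constraints become strict at a cost at most [e] in norm. *)
Definition ramp (t r : R) : R := Num.max (- t) (Num.min r 0).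

Lemma ramp_in (t r : R) : - t <= r -> r <= 0 -> ramp t r = r.
Proof. by move=> tr r0; rewrite /ramp min_l// max_r. Qed.

Lemma ramp_norm_le (t r : R) : 0 <= t -> `|ramp t r| <= `|r|.
Proof.
move=> t0; rewrite /ramp; have [r0|r0] := leP r 0.
  have [h|h] := leP (- t) r; first by [].
  by rewrite normrN ger0_norm// ler0_norm//; lra.
by rewrite max_r ?oppr_le0// normr0.
Qed.

Lemma ramp_bounded (t r : R) : 0 <= t -> `|ramp t r| <= t.
Proof.
move=> t0; rewrite ler_norml /ramp le_max lexx/= ge_max ge_min t0 orbT andbT.
by lra.
Qed.

Lemma continuous_ramp (t : R) : continuous (ramp t).
Proof.
move=> r.
have hmin : {for r, continuous (fun r : R => Num.min r 0)}.
  by apply: (@continuous_min _ _ id (cst 0) r); [exact: cvg_id|exact: cvg_cst].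
have := @continuous_max _ _ (cst (- t)) _ r _ hmin; apply.
exact: cvg_cst.
Qed.

Lemma sublinear_ramp (t : R) : 0 <= t -> sublinear (ramp t).
Proof.
move=> t0 e e0; exists (t / e) => r; rewrite ler_pdivrMr// => h.
by apply: le_trans (ramp_bounded r t0) _; rewrite mulrDr mulr1; lra.
Qed.

End Omega.

(** * The optimal path: constraints, norm and closure *)

Section OptimalPath.
Context {R : realType} {d : measure_display} {T : measurableType d}.
Variables (P : probability T R) (v : R -> R) (A : nat -> R -> T -> R).
Variables (b c1 c2 ts ss : R).
Local Notation g := (sqrtv v).
Local Notation t0 := (b / (c1 - c2)).
Hypotheses (vF : variance_fun v) (iidA : iid_gaussian_copies P v A).
Hypotheses (gmono : forall x y : R, 0 <= x -> x < y -> g x < g y).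
Hypotheses (det_neq0 : forall s t : R, 0 < s -> s < t -> detSigma v s t != 0).
Hypotheses (b0 : 0 < b) (c20 : 0 < c2) (c21 : c2 < c1).
Hypotheses (ts_t0 : t0 < ts) (ss0 : 0 < ss) (ss_ts : ss < ts).

Local Notation th1 := (theta1 v b c1 c2 ss ts).
Local Notation th2 := (theta2 v b c1 c2 ss ts).

(* The conditional mean of [A(-s,0)] given [A(-ts,0) = b + c2 ts] and [A(-ss,0) = c1 ss]. *)
Definition mean_path (s : R) : R := th1 * Gam v s ts + th2 * Gam v s ss.
Local Notation F := mean_path.

Let v0 : v 0 = 0. Proof. by case: vF. Qed.
Let vgt0 (t : R) : 0 < t -> 0 < v t. Proof. exact: (v_gt0 vF gmono). Qed.
Let ts0 : 0 < ts. Proof. exact: lt_trans ss0 ss_ts. Qed.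
Let vts : 0 < v ts. Proof. exact: vgt0. Qed.
Let psd (a c x y : R) : 0 <= x -> 0 <= y -> 0 <= quad3 v a c 0 x y x.
Proof. by move=> x0 y0; exact: (quad3_ge0 v0 iidA). Qed.
Let det : 0 < detSigma v ss ts. Proof. exact: (detSigma_gt0 vF gmono psd det_neq0). Qed.

Lemma fstarE r : fstar v b c1 c2 ss ts r = - F (- r).
Proof. by rewrite /fstar /mean_path; ring. Qed.

Lemma mean_path0 : F 0 = 0.
Proof. by rewrite /mean_path !(Gam0 _ v0) !mulr0 addr0. Qed.

Lemma mean_path_ts : F ts = b + c2 * ts.
Proof.
move: det; rewrite /mean_path /theta1 /theta2 (Gam_diag _ v0) gtr0_norm//.
by rewrite (GamC v ts ss) /detSigma => dt; field; rewrite gt_eqF.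
Qed.

Lemma continuous_mean_path : continuous F.
Proof.
move=> s; apply: cvgD; apply: cvgM; first [exact: cvg_cst|exact: (continuous_Gam vF)].
Qed.

Let X s := kfun v b c2 s ts - c1 * s.
Let Gb s := Gam v s ss - Gam v s ts * Gam v ss ts / v ts.

(** Conditioning in two stages: given [A(-ts,0)] the excess over [c1 s] is [X s]; imposing zero
    excess at [ss] then subtracts its regression. This is the link with [m] and [rho]. *)
Lemma mean_path_regression s :
  F s - c1 * s = X s - Gb s / vcond v ss ts * X ss.
Proof.
move: det; rewrite /mean_path /theta1 /theta2 /X /Gb /vcond /kfun /detSigma => dt.
by field; rewrite !gt_eqF.
Qed.

Hypothesis vbar_gt0 : forall r, - ts < r -> r < 0 -> 0 < vbar v ts r.
Hypothesis mbar_neq0 : mbar v b c1 c2 ts (- ss) != 0.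
Hypothesis m_le_rho : forall s, 0 < s -> s < ts ->
     m_ratio v b c1 c2 ts ss (- s) <= rhofun v ts ss (- s).

Let vbE : vbar v ts (- ss) = vcond v ss ts.
Proof.
rewrite /vbar /Gbar !opprK (Gam_diag _ v0) gtr0_norm// /vcond /detSigma.
by field; rewrite gt_eqF.
Qed.

Let X_neq0 : X ss != 0.
Proof.
apply: contra_neq mbar_neq0 => Xss; rewrite /mbar /Ebar opprK mulrN.
by move: Xss; rewrite /X /kfun => ->; rewrite mul0r.
Qed.

(** With conditional deviations [a] at [s] and [c] at [ss], multiplying [m <= rho] by [a * X ss / c]
    compares [X s] with the regression term; the sign of [X ss] decides the direction. *)
Let mean_path_sign s : 0 < s -> s < ts ->
  if 0 < X ss then F s <= c1 * s else c1 * s <= F s.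
Proof.
move=> s0 sts; have := m_le_rho s0 sts.
have vs : 0 < vbar v ts (- s) by apply: vbar_gt0; rewrite ?ltrN2 ?oppr_lt0.
have vss : 0 < vbar v ts (- ss) by apply: vbar_gt0; rewrite ?ltrN2 ?oppr_lt0.
have := mean_path_regression s; rewrite -vbE.
rewrite /m_ratio /mbar /rhofun /Ebar.
rewrite !opprK !mulrN -/(X s) -/(X ss).
have -> : Gbar v ts (- s) (- ss) = Gb s by rewrite /Gbar !opprK.
have sv : 0 < Num.sqrt (vbar v ts (- s)) by rewrite sqrtr_gt0.
have svs : 0 < Num.sqrt (vbar v ts (- ss)) by rewrite sqrtr_gt0.
rewrite -{1}[vbar v ts (- ss)](@sqr_sqrtr _ (vbar v ts (- ss))) ?(ltW vss)//.
move: sv svs; set a := Num.sqrt _; set c := Num.sqrt _ => a0 c0 FE h.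
have XE : X s = X s / a / (X ss / c) * (a * X ss / c).
  by field; rewrite X_neq0 !gt_eqF.
have YE : Gb s / c ^+ 2 * X ss = Gb s / (a * c) * (a * X ss / c).
  by field; rewrite !gt_eqF.
case: ltP => Xss.
  have k0 : 0 <= a * X ss / c by rewrite divr_ge0 ?mulr_ge0// ltW.
  by have := ler_wpM2r k0 h; rewrite -XE -YE; move: FE; lra.
have k0 : a * X ss / c <= 0.
  by rewrite pmulr_lle0 ?invr_gt0// pmulr_rle0.
by have := ler_wnM2r k0 h; rewrite -XE -YE; move: FE; lra.
Qed.

(* Otherwise [F s >= c1 * s] up to [s = ts], where it contradicts [ts > t0]. *)
Lemma kfun_ss_gt : c1 * ss < kfun v b c2 ss ts.
Proof.
rewrite -subr_gt0 -/(X ss) ltNge; apply/negP => Xss.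
have Fge s : 0 < s -> s < ts -> c1 * s <= F s.
  by move=> s0 sts; have := mean_path_sign s0 sts; rewrite ltNge Xss.
have gap := t0_lt c21 ts_t0.
have cF : (fun s : R => F s - c1 * s) @ ts --> F ts - c1 * ts.
  apply: cvgB; first exact: continuous_mean_path.
  by apply: cvgM; [exact: cvg_cst|exact: cvg_id].
rewrite mean_path_ts in cF.
have /cvgrPdist_lt/(_ (c1 * ts - (b + c2 * ts))) := cF.
rewrite subr_gt0 => /(_ gap)/nbhs_ballP[r /= r0 H].
pose s := ts - Num.min (r / 2) (ts / 2).
have m0 : 0 < Num.min (r / 2) (ts / 2) by rewrite lt_min !divr_gt0.
have m1 : Num.min (r / 2) (ts / 2) <= r / 2 by rewrite ge_min lexx.
have m2 : Num.min (r / 2) (ts / 2) <= ts / 2 by rewrite ge_min lexx orbT.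
have s0 : 0 < s by rewrite /s; move: m2 ts0; lra.
have sts : s < ts by rewrite /s; lra.
have := H s; rewrite /ball/= ltr_distlC (_ : _ && _); last first.
  by rewrite /s; apply/andP; split; lra.
move=> /(_ isT); rewrite ltr_distlC => /andP[_].
by have := Fge s s0 sts; lra.
Qed.

Lemma mean_path_le s : 0 <= s -> s < ts -> F s <= c1 * s.
Proof.
rewrite le_eqVlt => /orP[/eqP<- _|s0 sts]; first by rewrite mean_path0 mulr0.
by have := mean_path_sign s0 sts; rewrite subr_gt0 kfun_ss_gt.
Qed.

Local Notation Jval := (Lam v ss ts (b + c2 * ts) (b + c2 * ts - c1 * ss)).

(** The quadratic form is unchanged when the increment [A(-ts,-ss)] is replaced by [A(-ss,0)]; thus
    the half-space used below has rate [Jval] before its weight is raised. *)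
Lemma quad3_theta : quad3 v th1 th2 0 ts ss ts = 2 * Jval.
Proof.
move: det; rewrite (LamE vF gmono psd det_neq0)// /quad3 /theta1 /theta2 /vcond.
by rewrite (GamC v ts ss) /detSigma => dt; field; rewrite !gt_eqF.
Qed.

Lemma Jval_gt0 : 0 < Jval.
Proof.
rewrite (LamE vF gmono psd det_neq0)// ltr_wpDr//.
  rewrite divr_ge0 ?sqr_ge0// mulr_ge0// ltW//.
  exact: (vcond_gt0 vF gmono psd det_neq0).
by rewrite divr_gt0 ?exprn_gt0 ?mulr_gt0// addr_gt0// mulr_gt0.
Qed.

Lemma Irate_fstar : Irate v (fstar v b c1 c2 ss ts) = Jval%:E.
Proof.
rewrite /Irate.
rewrite (@rkhs_norm2_two_points _ _ _ P v A iidA _ (- ts) (- ss) (- th1) (- th2)).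
- rewrite -EFinM; congr EFin.
  have := quad3_theta; rewrite /quad3 !GamN !(Gam_diag _ v0) !gtr0_norm//; lra.
- move=> r; rewrite fstarE /mean_path -[in RHS](opprK r) !GamN; ring.
have := Jval_gt0; have := quad3_theta.
rewrite /quad3 !GamN !(Gam_diag _ v0) !gtr0_norm//; lra.
Qed.

(** Cauchy-Schwarz bounds the square by [v |r| * v |p|], and [v] grows more slowly than the
    square. *)
Lemma sublinear_Gam (p : R) : p != 0 -> sublinear (fun r => Gam v (- r) p).
Proof.
move=> p0 e e0.
have vp : 0 < v `|p| by apply: vgt0; rewrite normr_gt0.
have c0 : 0 < e / Num.sqrt (v `|p|) by rewrite divr_gt0// sqrtr_gt0.
have [T1 T10 HT] := variance_ln_bound 1 vF c0.
exists (Num.max 1 T1) => r; rewrite ge_max => /andP[r1 /HT].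
have lnr : 0 <= ln `|r| by exact: ln_ge0.
have vr : 0 < v `|r| by apply: vgt0; apply: lt_le_trans r1.
have lv : 0 <= ln `|r| * v `|r| by rewrite mulr_ge0// ltW.
have -> : (e / Num.sqrt (v `|p|) * `|r|) ^+ 2 = (e * `|r|) ^+ 2 / v `|p|.
  by rewrite mulrAC exprMn exprVn sqr_sqrtr// ltW.
rewrite ler_pdivlMr// => h.
have h2 : v `|r| * v `|p| <= (e * `|r|) ^+ 2.
  apply: le_trans h; rewrite ler_pM2r//; move: lv vr; lra.
apply: (@le_trans _ _ (e * `|r|)); last by rewrite ler_pM2l// lerDr.
rewrite -ler_sqr ?nnegrE ?mulr_ge0 ?(ltW e0)//.
rewrite real_normK ?num_real// (le_trans (Gam_CS v0 iidA _ vp))//.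
by rewrite normrN.
Qed.

Lemma fstar_closure : Omega_closure (Sset b c1 c2) (fstar v b c1 c2 ss ts).
Proof.
have cf : continuous (fstar v b c1 c2 ss ts).
  rewrite (_ : fstar _ _ _ _ _ _ = fun r => - F (- r)); last first.
    by apply/funext => r; exact: fstarE.
  move=> r; apply: cvgN; apply: (cvg_comp (fun r : R => - r) F).
    exact: opp_continuous.
  exact: continuous_mean_path.
have f0 : fstar v b c1 c2 ss ts 0 = 0 by rewrite fstarE oppr0 mean_path0 oppr0.
have sf : sublinear (fstar v b c1 c2 ss ts).
  rewrite (_ : fstar _ _ _ _ _ _ =
    fun r => (- th1) * Gam v (- r) ts + (- th2) * Gam v (- r) ss); last first.
    by apply/funext => r; rewrite /fstar !mulNr.
  by apply: sublinearD; apply: sublinearZ; apply: sublinear_Gam; rewrite gt_eqF.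
split; first exact: in_Omega_sublinear.
move=> e e0; exists (fun r => fstar v b c1 c2 ss ts r + e * ramp ts r); split.
  split.
    apply: in_Omega_sublinear.
    - move=> r; apply: cvgD; first exact: cf.
      by apply: cvgM; [exact: cvg_cst|exact: continuous_ramp].
    - by rewrite f0 ramp_in ?oppr_le0 ?(ltW ts0)// mulr0 addr0.
    - by apply: sublinearD => //; apply: sublinearZ; apply: sublinear_ramp; exact: ltW.
  exists ts; split => // s s0 sts.
  rewrite !fstarE !opprK mean_path_ts !ramp_in ?lerN2 ?oppr_le0 ?(ltW ts0) ?(ltW s0) ?(ltW sts)//.
  have := mean_path_le (ltW s0) sts.
  have : e * s < e * ts by rewrite ltr_pM2l.
  lra.
move=> r; rewrite opprD addNKr normrN normrM gtr0_norm// ler_pM2l//.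
by apply: le_trans (ramp_norm_le r (ltW ts0)) _; rewrite lerDr.
Qed.

End OptimalPath.

Theorem theorem3p11 (R : realType) (d : measure_display) (T : measurableType d)
  (P : probability T R) (v : R -> R) (A : nat -> R -> T -> R)
  (b c1 c2 tF ts ss : R) :
  variance_fun v ->
  iid_gaussian_copies P v A ->
  (forall s t, 0 < s -> s < t -> detSigma v s t != 0) ->
  0 < b -> 0 < c2 -> c2 < c1 ->
  assumptionA v ->
  (* tF is a minimizer of L_{c2} on (0,oo), and c1 < c1^F *)
  0 < tF -> (forall t, 0 < t -> Lc v b c2 tF <= Lc v b c2 t) ->
  (c1%:E < c1F v b c2 tF)%E ->
  (* ts > t0 minimizes t |-> sup_{s in (0,t)} Upsilon(s,t) over t > t0 *)
  b / (c1 - c2) < ts ->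
  (forall t, b / (c1 - c2) < t -> (supUps v b c1 c2 ts <= supUps v b c1 c2 t)%E) ->
  (* ss in (0,ts) maximizes s |-> Upsilon(s,ts) over (0,ts) *)
  0 < ss -> ss < ts ->
  (forall s, 0 < s -> s < ts -> Ups v b c1 c2 s ts <= Ups v b c1 c2 ss ts) ->
  (forall r, - ts < r -> r < 0 -> 0 < vbar v ts r) ->
  mbar v b c1 c2 ts (- ss) != 0 ->
  (forall s, 0 < s -> s < ts ->
     m_ratio v b c1 c2 ts ss (- s) <= rhofun v ts ss (- s)) ->
  let Jval := Lam v ss ts (b + c2 * ts) (b + c2 * ts - c1 * ss) in
  [/\ logprob_seq P A b c1 c2 @ \oo --> - Jval,
      ereal_inf [set supUps v b c1 c2 t | t in `]b / (c1 - c2), +oo[] = Jval%:E,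
      Omega_closure (Sset b c1 c2) (fstar v b c1 c2 ss ts) &
      Irate v (fstar v b c1 c2 ss ts) = Jval%:E].
Proof.
move=> vF iidA det_neq0 b0 c20 c21 [[g1 [g2 [dg12 cg1 _]]] gmono gconc] _ _ _.
move=> ts_t0 ts_min ss0 ss_ts ss_max vbar_gt0 mbar_neq0 m_le_rho Jval.
have dg (t : R) : 0 < t -> is_derive t 1 (sqrtv v) (g1 t) by move=> /dg12[].
have v0 : v 0 = 0 by case: vF.
have ts0 : 0 < ts := lt_trans ss0 ss_ts.
have G0 := g1_0_gt0 vF dg cg1 gmono gconc.
have vG (u : R) : 0 <= u -> v u <= (g1 0 * u) ^+ 2 by exact: (v_le_sqr vF dg cg1 gmono gconc).
have vgt0 (t : R) : 0 < t -> 0 < v t by exact: (v_gt0 vF gmono).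
have kss := kfun_ss_gt vF iidA gmono det_neq0 c21 ts_t0 ss0 ss_ts vbar_gt0 mbar_neq0 m_le_rho.
have UpsJ : Ups v b c1 c2 ss ts = Jval by rewrite /Ups kss.
have supJ : supUps v b c1 c2 ts = Jval%:E.
  apply/eqP; rewrite eq_le; apply/andP; split.
    apply: ge_ereal_sup => y [s /=]; rewrite in_itv/= => /andP[s0 sts] <-.
    by rewrite lee_fin -UpsJ; exact: ss_max.
  by apply: ereal_sup_ubound; exists ss; rewrite ?UpsJ//= in_itv/= ss0.
have HJ t : b / (c1 - c2) < t -> (Jval%:E <= supUps v b c1 c2 t)%E.
  by move=> /ts_min; rewrite supJ.
have mQ n := measurable_Q2_gt iidA n b c1 c2.
split.
- apply: log_rate_cvg.
    move=> x xJ.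
    have [C C0 HC] := Q2_exp_small vF iidA dg cg1 gmono gconc det_neq0 b0 c20 c21 HJ xJ.
    exists C => // n n0; have [M [mM sM PM]] := HC n n0.
    rewrite -lee_fin fineK ?fin_num_measure//; apply: le_trans PM.
    by apply: le_measure; rewrite ?inE.
  move=> y Jy.
  pose th1 := theta1 v b c1 c2 ss ts; pose th2 := theta2 v b c1 c2 ss ts.
  pose y0 := b + c2 * ts.
  have y00 : 0 < y0 by rewrite addr_gt0// mulr_gt0.
  have qE (ep : R) : quad3 v (th1 + ep) th2 0 ts ss ts = 2 * Jval + 2 * ep * y0 + ep ^+ 2 * v ts.
    rewrite /Jval -(quad3_theta b c1 c2 vF iidA gmono det_neq0)// -/th1 -/th2.
    rewrite /y0 -(mean_path_ts b c1 c2 vF iidA gmono det_neq0 ss0 ss_ts) /mean_path -/th1 -/th2.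
    by rewrite (Gam_diag _ v0) gtr0_norm// /quad3; ring.
  have [ep ep0 epy] : exists2 ep : R, 0 < ep & quad3 v (th1 + ep) th2 0 ts ss ts / 2 < y.
    (* Half the variance is [Jval + ep y0 + ep^2 v ts / 2]; with [ep <= 1] the increase is at most
       [ep (2 y0 + v ts) / 2 <= (y - Jval) / 2]. *)
    pose ep := Num.min 1 ((y - Jval) / (2 * y0 + v ts)).
    have k0 : 0 < 2 * y0 + v ts by rewrite addr_gt0 ?mulr_gt0// vgt0.
    have ep0 : 0 < ep by rewrite lt_min ltr01 divr_gt0// subr_gt0.
    have ep1 : ep <= 1 by rewrite ge_min lexx.
    have epk : ep * (2 * y0 + v ts) <= y - Jval.
      by rewrite -ler_pdivlMr// ge_min lexx orbT.
    exists ep => //; rewrite qE.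
    have h : ep ^+ 2 * v ts <= ep * v ts by rewrite ler_pM2r ?vgt0// expr2 ler_piMl// ltW.
    have : 0 < ep * y0 by rewrite mulr_gt0.
    have : 0 < ep * v ts by rewrite mulr_gt0// vgt0.
    lra.
  have Jp : 0 < Jval := Jval_gt0 c1 vF iidA gmono det_neq0 b0 c20 ss0 ss_ts.
  have q0 : 0 < quad3 v (th1 + ep) th2 0 ts ss ts.
    rewrite qE; have : 0 < ep * y0 by rewrite mulr_gt0.
    have : 0 <= ep ^+ 2 * v ts by rewrite mulr_ge0 ?sqr_ge0// ltW// vgt0.
    lra.
  (* The increment [ep] adds [ep (Gam ts ts - Gam s ts) > 0] for [s < ts]; at [s = ts] strictness
     comes from [ts > t0]. *)
  have F_gap s : 0 <= s -> s <= ts -> b + c2 * ts - c1 * s <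
      ((th1 + ep) * Gam v ts ts + th2 * Gam v ts ss) -
      ((th1 + ep) * Gam v s ts + th2 * Gam v s ss).
    move=> s0; have Fts := mean_path_ts b c1 c2 vF iidA gmono det_neq0 ss0 ss_ts.
    rewrite /mean_path -/th1 -/th2 in Fts.
    rewrite le_eqVlt => /orP[/eqP->|sts]; first by have := t0_lt c21 ts_t0; lra.
    have := mean_path_le vF iidA gmono det_neq0 c21 ts_t0 ss0 ss_ts vbar_gt0 mbar_neq0 m_le_rho s0 sts.
    rewrite /mean_path -/th1 -/th2 => Fs.
    have : Gam v s ts < Gam v ts ts.
      rewrite (Gam_diag _ v0) /Gam (ger0_norm s0) gtr0_norm// gtr0_norm ?subr_gt0//.
      have := v_lt vF gmono s0 sts; have : 0 < v (ts - s) by rewrite vgt0// subr_gt0.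
      lra.
    rewrite -(ltr_pM2l ep0); lra.
  have := Q2_prob_ge vF iidA G0 vG vgt0 c20 c21 ts0 ss0 q0 ts_t0 F_gap epy.
  by apply: filterS => n; rewrite -lee_fin fineK ?fin_num_measure.
- apply/eqP; rewrite eq_le; apply/andP; split.
    by rewrite -supJ; apply: ereal_inf_lbound; exists ts => //=; rewrite in_itv/= ts_t0.
  by apply: le_ereal_inf_tmp => z [t /=]; rewrite in_itv/= andbT => tt <-; exact: HJ.
- exact: (fstar_closure vF iidA gmono det_neq0 c21 ts_t0 ss0 ss_ts vbar_gt0 mbar_neq0 m_le_rho).
- exact: (Irate_fstar c1 vF iidA gmono det_neq0 b0 c20 ss0 ss_ts).
Qed.
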